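(* $\mathsf{WWKL}^\Delta\equiv_{sW}\mathsf{PC}_{2^\mathbb{N}}^\Delta\equiv_{sW}\mathsf{PC}_{\mathbb{R}}\equiv_{sW}\mathsf{PC}_{\mathbb{N}\times2^\mathbb{N}}$.
   Context: A represented space is a pair $(X,\delta_X)$ with $\delta_X:\subseteq\mathbb{N}^\mathbb{N}\to X$ a partial surjection; $\mathbb R$ carries its Cauchy representation. A realizer of $f:\subseteq X\rightrightarrows Y$ is a partial $F$ with $\delta_Y F(p)\in f(\delta_X(p))$ for all $p\in\mathrm{dom}(f\circ\delta_X)$. $f\le_{sW}g$ if there are computable partial $H,K:\subseteq\mathbb{N}^\mathbb{N}\to\mathbb{N}^\mathbb{N}$ such that $HGK$ realizes $f$ for every realizer $G$ of $g$; $\equiv_{sW}$ is the induced equivalence. $\mathcal{A}_-(X)$ denotes the closed subsets of $X$ represented by negative information (a name of $A$ enumerates basic open sets whose union is $X\setminus A$). For a Borel measure $\mu$ on $X$, $\mathsf{PC}_X:\subseteq\mathcal A_-(X)\rightrightarrows X$, $A\mapsto A$, is defined on closed $A$ with $\mu(A)>0$. Measures: $\mathbb N$ counting measure, $2^\mathbb N$ uniform product measure ($\mu(w2^\mathbb N)=2^{-|w|}$), $\mathbb R$ Lebesgue measure, $\mathbb N\times2^\mathbb N$ product measure. $\mathrm{Tr}$ is the set of binary trees $T\subseteq\{0,1\}^*$, represented by characteristic functions, $[T]$ its set of infinite paths; $\mathsf{WWKL}:\subseteq\mathrm{Tr}\rightrightarrows 2^\mathbb N$, $T\mapsto[T]$,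 has domain $\{T:\mu([T])>0\}$. Discrete jump: $\lim_\Delta:\subseteq\mathbb N^\mathbb N\to\mathbb N^\mathbb N$ maps $\langle p_0,p_1,\dots\rangle$ (where $\langle p_0,p_1,\dots\rangle\langle i,j\rangle=p_i(j)$) to $\lim_i p_i$, restricted to sequences $(p_i)$ that are eventually constant. The discrete jump $f^\Delta$ of $f:\subseteq(X,\delta_X)\rightrightarrows(Y,\delta_Y)$ is the same multi-valued function with input representation $\delta_X\circ\lim_\Delta$. *)

(* Defs.v *)
From Stdlib Require Import Reals Lra Lia ZArith Arith List.
From Stdlib Require Cantor.
Import ListNotations.
Open Scope R_scope.

Definition Baire := nat -> nat.

Definition pair (i j : nat) : nat := Cantor.to_nat (i, j).
Definition unpair (k : nat) : nat * nat := Cantor.of_nat k.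

Fixpoint code_list (l : list nat) : nat :=
  match l with
  | [] => 0%nat
  | x :: l' => S (pair x (code_list l'))
  end.

Definition prefix {A : Type} (p : nat -> A) (n : nat) : list A := map p (seq 0 n).

(** Bijective coding of binary words: 0 <-> [], 2m+1 <-> false::w_m, 2m+2 <-> true::w_m *)
Fixpoint word_aux (fuel n : nat) : list bool :=
  match fuel with
  | O => []
  | S f => match n with
           | O => []
           | S k => Nat.odd k :: word_aux f (Nat.div2 k)
           end
  end.
Definition wordof (n : nat) : list bool := word_aux n n.

Fixpoint codeword (w : list bool) : nat :=
  match w with
  | [] => 0%nat
  | false :: w' => S (2 * codeword w')
  | true :: w' => S (S (2 * codeword w'))
  end.

Definition zigzag (n : nat) : Z :=
  if Nat.even n then Z.of_nat (Nat.div2 n) else (- Z.of_nat (Nat.div2 (S n)))%Z.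
Definition qval (k : nat) : R :=
  let (a, b) := unpair k in IZR (zigzag a) / INR (S b).

Inductive recf : Type :=
| rZero : recf
| rSucc : recf
| rProj : nat -> recf
| rComp : recf -> list recf -> recf
| rPrim : recf -> recf -> recf
| rMu : recf -> recf.

Inductive reval : recf -> list nat -> nat -> Prop :=
| ev_zero xs : reval rZero xs 0
| ev_succ x xs : reval rSucc (x :: xs) (S x)
| ev_proj i xs y : nth_error xs i = Some y -> reval (rProj i) xs y
| ev_comp f gs xs ys z :
    Forall2 (fun g y => reval g xs y) gs ys -> reval f ys z -> reval (rComp f gs) xs z
| ev_prim0 f g xs y : reval f xs y -> reval (rPrim f g) (0%nat :: xs) y
| ev_primS f g n xs y z :
    reval (rPrim f g) (n :: xs) y -> reval g (n :: y :: xs) z ->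
    reval (rPrim f g) (S n :: xs) z
| ev_mu f xs n :
    reval f (n :: xs) 0 ->
    (forall m, (m < n)%nat -> exists k, reval f (m :: xs) (S k)) ->
    reval (rMu f) xs n.

Definition total_recursive (h : nat -> nat) : Prop :=
  exists r : recf, forall n, reval r [n] (h n).

Definition pfun := Baire -> Baire -> Prop.

Definition functional (F : pfun) : Prop :=
  forall p q q', F p q -> F p q' -> forall n, q n = q' n.

(** F :⊆ N^N -> N^N is computable: there is a computable h such that, on every
    p in dom F, h(<k, code(p[0..n))>) is 0 ("no answer yet") or F(p)(k)+1, and
    the answer F(p)(k)+1 appears for some n.  (Type-2 computability.) *)
Definition computable (F : pfun) : Prop :=
  exists h : nat -> nat, total_recursive h /\
    forall p q, F p q -> forall k,
      (exists n, h (pair k (code_list (prefix p n))) = S (q k)) /\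
      (forall n, h (pair k (code_list (prefix p n))) = 0%nat \/
                 h (pair k (code_list (prefix p n))) = S (q k)).

Definition pcomp (H G K : pfun) : pfun :=
  fun p r => exists q s, K p q /\ G q s /\ H s r.

Record RepSpace := {
  carrier : Type;
  rep : Baire -> carrier -> Prop   (* rep p x  means  delta(p) = x *)
}.

(** A multi-valued function f :⊆ X ⇉ Y is a relation; dom f = {x | exists y, f x y}. *)
Definition mvf (X Y : RepSpace) := carrier X -> carrier Y -> Prop.

Definition realizes {X Y : RepSpace} (f : mvf X Y) (F : pfun) : Prop :=
  forall p x, rep X p x -> (exists y, f x y) ->
    exists q, F p q /\
      forall q', F p q' -> exists y, rep Y q' y /\ f x y.

Definition sW_le {X Y Z W : RepSpace} (f : mvf X Y) (g : mvf Z W) : Prop :=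
  exists H K : pfun, computable H /\ computable K /\
    forall G : pfun, functional G -> realizes g G -> realizes f (pcomp H G K).

Definition sW_equiv {X Y Z W : RepSpace} (f : mvf X Y) (g : mvf Z W) : Prop :=
  sW_le f g /\ sW_le g f.

(** <p_0,p_1,...><i,j> = p_i(j); lim_Delta defined on eventually constant sequences. *)
Definition column (q : Baire) (i : nat) : Baire := fun j => q (pair i j).

Definition lim_Delta (q p : Baire) : Prop :=
  exists N, (forall i, (N <= i)%nat -> forall j, column q i j = column q N j) /\
            (forall j, p j = column q N j).

Definition jump_space (X : RepSpace) : RepSpace := {|
  carrier := carrier X;
  rep := fun q x => exists p, lim_Delta q p /\ rep X p x
|}.

(** f^Delta: the same multi-valued function, with input representation delta_X o lim_Delta *)
Definition djump {X Y : RepSpace} (f : mvf X Y) : mvf (jump_space X) Y := f.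

Definition bitn (b : bool) : nat := if b then 1%nat else 0%nat.

Definition Cantor_space : RepSpace := {|
  carrier := nat -> bool;
  rep := fun p x => forall n, p n = bitn (x n)
|}.

(** N x 2^N with the product representation <p,q>(2n)=p(n), <p,q>(2n+1)=q(n),
    N represented by p |-> p(0) *)
Definition NCantor_space : RepSpace := {|
  carrier := (nat * (nat -> bool))%type;
  rep := fun r mx => r 0%nat = fst mx /\ forall n, r (S (2 * n)) = bitn (snd mx n)
|}.

Definition R_space : RepSpace := {|
  carrier := R;
  rep := fun p x => forall n, Rabs (qval (p n) - x) <= (/ 2) ^ n
|}.

Definition in_cyl (w : list bool) (x : nat -> bool) : Prop := prefix x (length w) = w.

Definition basic_C (k : nat) (x : nat -> bool) : Prop := in_cyl (wordof k) x.
Definition basic_NC (k : nat) (mx : nat * (nat -> bool)) : Prop :=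
  let (m, j) := unpair k in fst mx = m /\ in_cyl (wordof j) (snd mx).
Definition basic_R (k : nat) (x : R) : Prop :=
  let (a, b) := unpair k in qval a < x < qval b.

(** A_-(X): closed sets by negative information; p(n)=0 enumerates nothing,
    p(n)=k+1 enumerates the k-th basic open set; the named set is the complement
    of the union of the enumerated basic open sets. *)
Definition closed_neg (T : Type) (basic : nat -> T -> Prop) : RepSpace := {|
  carrier := T -> Prop;
  rep := fun p A => forall x, A x <-> ~ (exists n k, p n = S k /\ basic k x)
|}.

Definition AC := closed_neg (nat -> bool) basic_C.
Definition ANC := closed_neg (nat * (nat -> bool)) basic_NC.
Definition AR := closed_neg R basic_R.

Definition partial_sum (a : nat -> R) (N : nat) : R :=
  fold_right Rplus 0 (map a (seq 0 N)).

(** uniform measure on 2^N: mu(w2^N) = 2^-|w| *)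
Definition null_C (A : (nat -> bool) -> Prop) : Prop :=
  forall eps, 0 < eps -> exists ws : nat -> list bool,
    (forall x, A x -> exists i, in_cyl (ws i) x) /\
    (forall N, partial_sum (fun i => (/ 2) ^ length (ws i)) N <= eps).

(** counting x uniform on N x 2^N: mu({m} x w2^N) = 2^-|w| *)
Definition null_NC (A : (nat * (nat -> bool)) -> Prop) : Prop :=
  forall eps, 0 < eps -> exists cs : nat -> (nat * list bool),
    (forall mx, A mx -> exists i, fst mx = fst (cs i) /\ in_cyl (snd (cs i)) (snd mx)) /\
    (forall N, partial_sum (fun i => (/ 2) ^ length (snd (cs i))) N <= eps).

Definition null_R (A : R -> Prop) : Prop :=
  forall eps, 0 < eps -> exists ab : nat -> (R * R),
    (forall x, A x -> exists i, fst (ab i) < x < snd (ab i)) /\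
    (forall N, partial_sum (fun i => Rmax 0 (snd (ab i) - fst (ab i))) N <= eps).

(** * Positive choice PC_X : A_-(X) ⇉ X, A |-> A, dom = {A | mu(A) > 0} *)
Definition PC_C : mvf AC Cantor_space := fun A x => ~ null_C A /\ A x.
Definition PC_NC : mvf ANC NCantor_space := fun A x => ~ null_NC A /\ A x.
Definition PC_R : mvf AR R_space := fun A x => ~ null_R A /\ A x.

Definition is_tree (T : list bool -> Prop) : Prop :=
  forall w v, T (w ++ v) -> T w.

Definition Tr_space : RepSpace := {|
  carrier := list bool -> Prop;
  rep := fun p T => is_tree T /\ (forall n, p n = 0%nat \/ p n = 1%nat) /\
                    (forall w, T w <-> p (codeword w) = 1%nat)
|}.

Definition paths (T : list bool -> Prop) (x : nat -> bool) : Prop :=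
  forall n, T (prefix x n).

Definition WWKL : mvf Tr_space Cantor_space :=
  fun T x => ~ null_C (paths T) /\ paths T x.

(* Main.v *)
(** The reductions form a closed walk
    WWKL^Delta <= PC_{2^N}^Delta <= PC_{N x 2^N} <= PC_R <= PC_{N x 2^N} <= WWKL^Delta.
    - A tree and the closed set of its paths carry the same information.
    - An eventually constant sequence of closed sets becomes a closed subset of N x 2^N:
      section n is the n-th set, and is removed once a later set is seen to differ.
    - N x 2^N embeds into R as countably many translates of a Cantor set of positive measure,
      psi(m,x) = 4 m + sum_i x_i (2^-(i+1) + 3 * 4^-(i+1)). Points of the image can be decoded
      from approximations, and psi increases distances at least as much as binary expansion
      does, so preimages of null sets are null.
    - Integer part plus binary expansion maps N x 2^N onto R, and images of null sets are null.
    - For A in N x 2^N of positive measure some section A_m has measure at least 2^-k. This is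
      refuted in finite time when it fails, so the first correct pair (m, k) is found with
      finitely many mind changes; the output is the tree of A_m, moved below the word 0^m 1. *)

Require Import Defs.
From Stdlib Require Import Reals Lra Lia ZArith Arith List.
From Stdlib Require Import FunctionalExtensionality Classical ClassicalEpsilon.
From Stdlib Require IndefiniteDescription FinFun.
Import ListNotations.
Open Scope nat_scope.

(** * Recursive functions *)

(** A strong reduction shows the backward map only the solution, so the solution must carry all that
    is needed. This is why the section number is written into the path as 0^m 1, and why the
    embedding into the reals must be decodable from approximations alone. Plain binary expansion is
    not, since digits jump at dyadic rationals; it serves only where expansions are turned into
    reals. In psi the terms 2^-(i+1) keep the measure positive and the terms 3 * 4^-(i+1) open gaps
    between cylinders; the section {m} x 2^N lands in [4 m, 4 m + 2], so sections are separated too.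
    A forward map into a jump may revise its output finitely often, which is what permits the search
    for (m, k). Measure enters only through coverings. For trees it becomes the number of words on a
    level: by compactness, a null set of paths leaves an arbitrarily small share of the words at
    some level, and this is decidable from finite data. Computability is meant literally, by
    mu-recursive functions on codes of finite prefixes; a calculus of tracked functions supplies
    them. *)

Definition rfun (k : nat) (f : list nat -> nat) : Prop :=
  exists r, forall xs, length xs = k -> reval r xs (f xs).

Definition rfun2 (g : nat -> nat -> nat) : Prop :=
  rfun 2 (fun xs => g (nth 0 xs 0) (nth 1 xs 0)).

Lemma rfun1 g : total_recursive g <-> rfun 1 (fun xs => g (nth 0 xs 0)).
Proof.
  split; intros [r Hr]; exists r.
  - intros [|a [|]] Hl; try discriminate; apply Hr.
  - intros n; apply (Hr [n]); reflexivity.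
Qed.

Lemma rfun_proj k i : i < k -> rfun k (fun xs => nth i xs 0).
Proof.
  intros Hi; exists (rProj i); intros xs Hl.
  constructor; apply nth_error_nth'; lia.
Qed.

Lemma rfun_comp k m f (gs : list (list nat -> nat)) :
  rfun m f -> length gs = m -> Forall (rfun k) gs ->
  rfun k (fun xs => f (map (fun g => g xs) gs)).
Proof.
  intros [r Hr] Hm Hgs.
  assert (exists rs, forall xs, length xs = k ->
            Forall2 (fun g y => reval g xs y) rs (map (fun g => g xs) gs)) as [rs Hrs].
  { clear Hm; induction Hgs as [|g gs [rg Hg] _ [rs IH]].
    - exists []; constructor.
    - exists (rg :: rs); intros xs Hl; constructor; auto. }
  exists (rComp r rs); intros xs Hl.
  eapply ev_comp; [apply Hrs, Hl|].
  apply Hr; rewrite length_map; exact Hm.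
Qed.

Lemma rfun_comp1 k g f :
  total_recursive g -> rfun k f -> rfun k (fun xs => g (f xs)).
Proof.
  intros Hg%rfun1 Hf.
  exact (rfun_comp k 1 _ [f] Hg eq_refl (Forall_cons _ Hf (Forall_nil _))).
Qed.

Lemma rfun_comp2 k g f1 f2 :
  rfun2 g -> rfun k f1 -> rfun k f2 -> rfun k (fun xs => g (f1 xs) (f2 xs)).
Proof.
  intros Hg H1 H2.
  exact (rfun_comp k 2 _ [f1; f2] Hg eq_refl
           (Forall_cons _ H1 (Forall_cons _ H2 (Forall_nil _)))).
Qed.

Lemma rfun_prim k b s :
  rfun k b -> rfun (S (S k)) s ->
  rfun (S k) (fun xs => nat_rect (fun _ => nat) (b (tl xs))
                          (fun i y => s (i :: y :: tl xs)) (hd 0 xs)).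
Proof.
  intros [rb Hb] [rs Hs]; exists (rPrim rb rs).
  intros [|n xs] Hl; [discriminate|]; injection Hl as Hl; simpl hd; simpl tl.
  induction n as [|n IH].
  - constructor; auto.
  - eapply ev_primS; [exact IH|]; apply Hs; simpl; lia.
Qed.

Lemma rfun_ext k f g : (forall xs, length xs = k -> f xs = g xs) -> rfun k f -> rfun k g.
Proof. intros E [r Hr]; exists r; intros xs Hl; rewrite <- E; auto. Qed.

Lemma total_recursive_ext f g : (forall n, f n = g n) -> total_recursive f -> total_recursive g.
Proof. intros E [r Hr]; exists r; intros n; rewrite <- E; auto. Qed.

Lemma total_recursive_S : total_recursive S.
Proof. exists rSucc; intros; constructor. Qed.

Lemma rfun_O k : rfun k (fun _ => 0).
Proof. exists rZero; intros; constructor. Qed.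

Lemma rfun_const k c : rfun k (fun _ => c).
Proof.
  induction c as [|c IH]; [apply rfun_O|].
  exact (rfun_comp1 k S _ total_recursive_S IH).
Qed.

Lemma rfun2_add : rfun2 Nat.add.
Proof.
  eapply rfun_ext; [|apply (rfun_prim 1 (fun xs => nth 0 xs 0) (fun xs => S (nth 1 xs 0)))].
  - intros [|n [|m [|]]] Hl; try discriminate; simpl.
    clear Hl; induction n; simpl; congruence.
  - apply rfun_proj; lia.
  - apply (rfun_comp1 _ S); [apply total_recursive_S | apply rfun_proj; lia].
Qed.

Lemma total_recursive_pred : total_recursive pred.
Proof.
  apply rfun1.
  eapply rfun_ext; [|apply (rfun_prim 0 (fun _ => 0) (fun xs => nth 0 xs 0))].
  - intros [|[|n] [|]] Hl; try discriminate; reflexivity.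
  - apply rfun_O.
  - apply rfun_proj; lia.
Qed.

Lemma rfun2_sub : rfun2 Nat.sub.
Proof.
  (* Primitive recursion runs on the first argument, so the subtrahend comes first here and the
     arguments are swapped back at the end. *)
  assert (H : rfun2 (fun n m => m - n)).
  { eapply rfun_ext; [|apply (rfun_prim 1 (fun xs => nth 0 xs 0) (fun xs => pred (nth 1 xs 0)))].
    - intros [|n [|m [|]]] Hl; try discriminate; simpl.
      clear Hl; induction n; simpl; [lia | rewrite IHn; lia].
    - apply rfun_proj; lia.
    - apply (rfun_comp1 _ pred); [apply total_recursive_pred | apply rfun_proj; lia]. }
  apply (rfun_comp2 2 (fun n m => m - n) (fun xs => nth 1 xs 0) (fun xs => nth 0 xs 0));
    [exact H | apply rfun_proj; lia | apply rfun_proj; lia].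
Qed.

(** * The Cantor pairing function and its inverse *)

Definition tri (n : nat) : nat := nat_rect (fun _ => nat) 0 (fun i m => S i + m) n.

Lemma total_recursive_tri : total_recursive tri.
Proof.
  apply rfun1.
  eapply rfun_ext; [|apply (rfun_prim 0 (fun _ => 0)
                       (fun xs => S (nth 0 xs 0) + (nth 1 xs 0)))].
  - intros [|n [|]] Hl; try discriminate; reflexivity.
  - apply rfun_O.
  - apply (rfun_comp2 2 Nat.add); [apply rfun2_add | | apply rfun_proj; lia].
    apply (rfun_comp1 _ S); [apply total_recursive_S | apply rfun_proj; lia].
Qed.

Lemma rfun2_pair : rfun2 pair.
Proof.
  apply (rfun_ext 2 (fun xs => nth 1 xs 0 + tri (nth 1 xs 0 + nth 0 xs 0))).
  (* [tri] has the very shape of the recursion inside [Cantor.to_nat], so this is a conversion. *)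
  - intros xs _; reflexivity.
  - apply (rfun_comp2 2 Nat.add); [apply rfun2_add | apply rfun_proj; lia |].
    apply (rfun_comp1 2 tri); [apply total_recursive_tri |].
    apply (rfun_comp2 2 Nat.add); [apply rfun2_add | |]; apply rfun_proj; lia.
Qed.

(** The antidiagonal containing the point numbered [n]; it grows by one exactly when
    the next triangular number is reached. *)
Definition diag (n : nat) : nat :=
  nat_rect (fun _ => nat) 0 (fun i d => d + (1 - (tri (S d) - S i))) n.

Lemma total_recursive_diag : total_recursive diag.
Proof.
  apply rfun1.
  eapply rfun_ext; [|apply (rfun_prim 0 (fun _ => 0)
     (fun xs => nth 1 xs 0 + (1 - (tri (S (nth 1 xs 0)) - S (nth 0 xs 0)))))].
  - intros [|n [|]] Hl; try discriminate; reflexivity.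
  - apply rfun_O.
  - apply (rfun_comp2 2 Nat.add); [apply rfun2_add | apply rfun_proj; lia |].
    apply (rfun_comp2 2 Nat.sub); [apply rfun2_sub | apply rfun_const |].
    apply (rfun_comp2 2 Nat.sub); [apply rfun2_sub | |].
    + apply (rfun_comp1 2 tri); [apply total_recursive_tri |].
      apply (rfun_comp1 2 S); [apply total_recursive_S | apply rfun_proj; lia].
    + apply (rfun_comp1 2 S); [apply total_recursive_S | apply rfun_proj; lia].
Qed.

Lemma unpair_pair i j : unpair (pair i j) = (i, j).
Proof. apply Cantor.cancel_of_to. Qed.

Lemma pair_unpair k : pair (fst (unpair k)) (snd (unpair k)) = k.
Proof.
  unfold pair, unpair; rewrite <- surjective_pairing; apply Cantor.cancel_to_of.
Qed.

Lemma pair_ge i j : i + j <= pair i j.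
Proof. unfold pair; pose proof (Cantor.to_nat_non_decreasing i j); lia. Qed.

Lemma tri_S n : tri (S n) = S n + tri n.
Proof. reflexivity. Qed.

Lemma tri_le m n : m <= n -> tri m <= tri n.
Proof. induction 1; [lia | rewrite tri_S; lia]. Qed.

Lemma diag_spec n : tri (diag n) <= n < tri (S (diag n)).
Proof.
  induction n as [|n IH]; [unfold tri; simpl; lia|].
  replace (diag (S n)) with (diag n + (1 - (tri (S (diag n)) - S n))) by reflexivity.
  destruct (Nat.eq_dec (tri (S (diag n))) (S n)) as [E|E].
  - rewrite E, Nat.sub_diag, Nat.add_comm; cbn [Nat.add Nat.sub].
    rewrite (tri_S (S _)); lia.
  - replace (1 - (tri (S (diag n)) - S n)) with 0 by lia; rewrite Nat.add_0_r; lia.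
Qed.

Lemma pair_tri i j : pair i j = j + tri (j + i).
Proof. reflexivity. Qed.

Lemma diag_pair i j : diag (pair i j) = j + i.
Proof.
  pose proof (diag_spec (pair i j)) as H; rewrite pair_tri in *.
  set (d := diag _) in *.
  destruct (Nat.lt_trichotomy d (j + i)) as [L|[L|L]]; [|exact L|].
  - pose proof (tri_le (S d) (j + i) L); lia.
  - pose proof (tri_le (S (j + i)) d L) as H1; rewrite (tri_S (j + i)) in H1; lia.
Qed.

Lemma snd_unpair k : snd (unpair k) = k - tri (diag k).
Proof.
  rewrite <- (pair_unpair k) at 2 3.
  rewrite diag_pair, pair_tri; lia.
Qed.

Lemma fst_unpair k : fst (unpair k) = diag k - snd (unpair k).
Proof. rewrite <- (pair_unpair k) at 2; rewrite diag_pair; lia. Qed.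

Lemma total_recursive_snd : total_recursive (fun k => snd (unpair k)).
Proof.
  eapply total_recursive_ext; [intros; symmetry; apply snd_unpair|].
  apply rfun1.
  apply (rfun_comp2 1 Nat.sub); [apply rfun2_sub | apply rfun_proj; lia |].
  apply (rfun_comp1 1 tri); [apply total_recursive_tri |].
  apply (rfun_comp1 1 diag); [apply total_recursive_diag | apply rfun_proj; lia].
Qed.

Lemma total_recursive_fst : total_recursive (fun k => fst (unpair k)).
Proof.
  eapply total_recursive_ext; [intros; symmetry; apply fst_unpair|].
  apply rfun1.
  apply (rfun_comp2 1 Nat.sub); [apply rfun2_sub | |].
  - apply (rfun_comp1 1 diag); [apply total_recursive_diag | apply rfun_proj; lia].
  - apply (rfun_comp1 1 (fun k => snd (unpair k)));
      [apply total_recursive_snd | apply rfun_proj; lia].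
Qed.

Lemma total_recursive_comp g f :
  total_recursive g -> total_recursive f -> total_recursive (fun n => g (f n)).
Proof.
  intros Hg Hf; apply rfun1; apply (rfun_comp1 1 g _ Hg); apply rfun1, Hf.
Qed.

Lemma total_recursive_pair f g :
  total_recursive f -> total_recursive g -> total_recursive (fun n => pair (f n) (g n)).
Proof.
  intros Hf Hg; apply rfun1.
  apply (rfun_comp2 1 pair); [apply rfun2_pair | apply rfun1, Hf | apply rfun1, Hg].
Qed.

Lemma total_recursive_prim b s n :
  total_recursive b -> total_recursive s -> total_recursive n ->
  total_recursive (fun a => nat_rect (fun _ => nat) (b a)
                              (fun i y => s (pair a (pair i y))) (n a)).
Proof.
  intros Hb Hs Hn; apply rfun1.
  assert (H : rfun2 (fun m a => nat_rect (fun _ => nat) (b a)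
                               (fun i y => s (pair a (pair i y))) m)).
  { eapply rfun_ext; [|apply (rfun_prim 1 (fun xs => b (nth 0 xs 0))
      (fun xs => s (pair (nth 2 xs 0) (pair (nth 0 xs 0) (nth 1 xs 0)))))].
    - intros [|m [|a [|]]] Hl; try discriminate; reflexivity.
    - apply rfun1, Hb.
    - apply (rfun_comp1 3 s _ Hs).
      apply (rfun_comp2 3 pair); [apply rfun2_pair | apply rfun_proj; lia |].
      apply (rfun_comp2 3 pair); [apply rfun2_pair | |]; apply rfun_proj; lia. }
  apply (rfun_comp2 1 _ _ _ H); [apply rfun1, Hn | apply rfun_proj; lia].
Qed.

(** * Codes of structured data *)

Class Enc (A : Type) := enc : A -> nat.
Instance enc_nat : Enc nat := fun n => n.
Instance enc_bool : Enc bool := bitn.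
Instance enc_prod {A B} `{Enc A} `{Enc B} : Enc (A * B) :=
  fun ab => pair (enc (fst ab)) (enc (snd ab)).
Instance enc_list {A} `{Enc A} : Enc (list A) := fun l => code_list (map enc l).

(** [f] is computable on codes; [enc] need not have a computable range, so this is a
    notion of tracking rather than of recursive function on a numbered set. *)
Definition Trk {A B} `{Enc A} `{Enc B} (f : A -> B) : Prop :=
  exists h, total_recursive h /\ forall a, h (enc a) = enc (f a).

Fixpoint natrec {B} (b : B) (s : nat -> B -> B) (n : nat) : B :=
  match n with
  | 0 => b
  | S i => s i (natrec b s i)
  end.

Section Tracked.
Context {A B C : Type} `{Enc A} `{Enc B} `{Enc C}.

Lemma trk_ext (f g : A -> B) : (forall a, f a = g a) -> Trk f -> Trk g.
Proof. intros E [h [Hh Hf]]; exists h; split; auto; intros; rewrite <- E; auto. Qed.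

Lemma trk_id : Trk (fun a : A => a).
Proof. exists (fun n => n); split; auto; apply rfun1, rfun_proj; lia. Qed.

Lemma trk_const (b : B) : Trk (fun _ : A => b).
Proof. exists (fun _ => enc b); split; auto; apply rfun1, rfun_const. Qed.

Lemma trk_comp (g : B -> C) (f : A -> B) : Trk g -> Trk f -> Trk (fun a => g (f a)).
Proof.
  intros [h [Hh Hg]] [k [Hk Hf]]; exists (fun n => h (k n)); split.
  - apply total_recursive_comp; auto.
  - intros a; rewrite Hf, Hg; reflexivity.
Qed.

Lemma trk_pair (f : A -> B) (g : A -> C) : Trk f -> Trk g -> Trk (fun a => (f a, g a)).
Proof.
  intros [h [Hh Hf]] [k [Hk Hg]]; exists (fun n => pair (h n) (k n)); split.
  - apply total_recursive_pair; auto.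
  - intros a; rewrite Hf, Hg; reflexivity.
Qed.

Lemma trk_fst (f : A -> B * C) : Trk f -> Trk (fun a => fst (f a)).
Proof.
  intros [h [Hh Hf]]; exists (fun n => fst (unpair (h n))); split.
  - apply (total_recursive_comp _ _ total_recursive_fst Hh).
  - intros a; rewrite Hf; unfold enc at 1, enc_prod; rewrite unpair_pair; reflexivity.
Qed.

Lemma trk_snd (f : A -> B * C) : Trk f -> Trk (fun a => snd (f a)).
Proof.
  intros [h [Hh Hf]]; exists (fun n => snd (unpair (h n))); split.
  - apply (total_recursive_comp _ _ total_recursive_snd Hh).
  - intros a; rewrite Hf; unfold enc at 1, enc_prod; rewrite unpair_pair; reflexivity.
Qed.

Lemma trk_natrec (b : A -> B) (s : A -> nat -> B -> B) (n : A -> nat) :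
  Trk b -> Trk (fun p : A * (nat * B) => s (fst p) (fst (snd p)) (snd (snd p))) -> Trk n ->
  Trk (fun a => natrec (b a) (s a) (n a)).
Proof.
  intros [hb [Rb Hb]] [hs [Rs Hs]] [hn [Rn Hn]].
  eexists; split; [exact (total_recursive_prim hb hs hn Rb Rs Rn)|].
  intros a; cbn beta; rewrite Hn; change (enc (n a)) with (n a).
  induction (n a) as [|m IH]; cbn [nat_rect natrec].
  - apply Hb.
  - rewrite IH; exact (Hs (a, (m, _))).
Qed.

Lemma trk_if (c : A -> bool) (f g : A -> B) :
  Trk c -> Trk f -> Trk g -> Trk (fun a => if c a then f a else g a).
Proof.
  intros [hc [Rc Hc]] [hf [Rf Hf]] [hg [Rg Hg]].
  eexists; split.
  (* The code 0 or 1 of the condition is the number of recursion steps: the base value is the else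
     branch, and one step produces the then branch. *)
  - apply (total_recursive_prim hg (fun k => hf (fst (unpair k))) hc); auto.
    apply (total_recursive_comp _ _ Rf total_recursive_fst).
  - intros a; cbn beta; rewrite Hc.
    change (enc (c a)) with (bitn (c a)).
    destruct (c a); cbn [bitn nat_rect]; [rewrite unpair_pair; apply Hf | apply Hg].
Qed.

Lemma trk_total (g : nat -> nat) (f : A -> nat) :
  total_recursive g -> Trk f -> Trk (fun a => g (f a)).
Proof.
  intros Hg [h [Hh Hf]]; exists (fun n => g (h n)); split.
  - apply total_recursive_comp; auto.
  - intros a; rewrite Hf; reflexivity.
Qed.

End Tracked.

(** * Functions tracked by recursive functions on codes *)

Create HintDb trk.
Hint Resolve trk_const trk_id trk_fst trk_snd trk_pair trk_natrec trk_if : trk.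
Hint Constants Opaque : trk.
Ltac trk := solve [eauto 100 with trk nocore].

Lemma trk_S {A} `{Enc A} (f : A -> nat) : Trk f -> Trk (fun a => S (f a)).
Proof. apply trk_total, total_recursive_S. Qed.

Lemma trk_pred {A} `{Enc A} (f : A -> nat) : Trk f -> Trk (fun a => pred (f a)).
Proof. apply trk_total, total_recursive_pred. Qed.

Hint Resolve trk_S trk_pred : trk.

Lemma trk_add {A} `{Enc A} (f g : A -> nat) : Trk f -> Trk g -> Trk (fun a => f a + g a).
Proof.
  intros Hf Hg.
  refine (trk_ext (fun a => natrec (g a) (fun _ y => S y) (f a)) _ _ _);
    [|trk].
  intros a; induction (f a); simpl; congruence.
Qed.

Lemma trk_sub {A} `{Enc A} (f g : A -> nat) : Trk f -> Trk g -> Trk (fun a => f a - g a).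
Proof.
  intros Hf Hg.
  refine (trk_ext (fun a => natrec (f a) (fun _ y => pred y) (g a)) _ _ _);
    [|trk].
  intros a; induction (g a) as [|n IH]; simpl; [lia|rewrite IH; lia].
Qed.

Hint Resolve trk_add trk_sub : trk.

Lemma trk_mul {A} `{Enc A} (f g : A -> nat) : Trk f -> Trk g -> Trk (fun a => f a * g a).
Proof.
  intros Hf Hg.
  refine (trk_ext (fun a => natrec 0 (fun _ y => g a + y) (f a)) _ _ _).
  - intros a; induction (f a); simpl; congruence.
  - apply trk_natrec; [trk| |trk].
    apply trk_add; [apply (trk_comp g fst Hg)|]; trk.
Qed.

Hint Resolve trk_mul : trk.

Lemma trk_pow {A} `{Enc A} (f g : A -> nat) : Trk f -> Trk g -> Trk (fun a => f a ^ g a).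
Proof.
  intros Hf Hg.
  refine (trk_ext (fun a => natrec 1 (fun _ y => f a * y) (g a)) _ _ _).
  - intros a; induction (g a); simpl; congruence.
  - apply trk_natrec; [trk| |trk].
    apply trk_mul; [apply (trk_comp f fst Hf)|]; trk.
Qed.

Lemma trk_is_zero {A} `{Enc A} (f : A -> nat) : Trk f -> Trk (fun a => f a =? 0).
Proof.
  intros Hf.
  refine (trk_ext (fun a => natrec true (fun _ _ => false) (f a)) _ _ _);
    [|trk].
  intros a; destruct (f a); reflexivity.
Qed.

Hint Resolve trk_is_zero : trk.

Lemma trk_eqb {A} `{Enc A} (f g : A -> nat) : Trk f -> Trk g -> Trk (fun a => f a =? g a).
Proof.
  intros Hf Hg.
  refine (trk_ext (fun a => (f a - g a) + (g a - f a) =? 0) _ _ _); [|trk].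
  intros a; destruct (Nat.eqb_spec (f a) (g a)), (Nat.eqb_spec ((f a - g a) + (g a - f a)) 0);
    auto; lia.
Qed.

Lemma trk_leb {A} `{Enc A} (f g : A -> nat) : Trk f -> Trk g -> Trk (fun a => f a <=? g a).
Proof.
  intros Hf Hg.
  refine (trk_ext (fun a => f a - g a =? 0) _ _ _); [|trk].
  intros a; destruct (Nat.leb_spec (f a) (g a)), (Nat.eqb_spec (f a - g a) 0); auto; lia.
Qed.

Lemma trk_negb {A} `{Enc A} (b : A -> bool) : Trk b -> Trk (fun a => negb (b a)).
Proof. exact (fun Hb => trk_if b _ _ Hb (trk_const false) (trk_const true)). Qed.

Lemma trk_andb {A} `{Enc A} (b c : A -> bool) : Trk b -> Trk c -> Trk (fun a => b a && c a)%bool.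
Proof. exact (fun Hb Hc => trk_if b _ _ Hb Hc (trk_const false)). Qed.

Lemma trk_orb {A} `{Enc A} (b c : A -> bool) : Trk b -> Trk c -> Trk (fun a => b a || c a)%bool.
Proof. exact (fun Hb Hc => trk_if b _ _ Hb (trk_const true) Hc). Qed.

Hint Resolve trk_eqb trk_leb trk_negb trk_andb trk_orb : trk.

Lemma trk_beqb {A} `{Enc A} (b c : A -> bool) : Trk b -> Trk c -> Trk (fun a => Bool.eqb (b a) (c a)).
Proof.
  intros Hb Hc.
  refine (trk_ext (fun a => if b a then c a else negb (c a)) _ _ _); [|trk].
  intros a; destruct (b a), (c a); reflexivity.
Qed.

Lemma trk_even {A} `{Enc A} (f : A -> nat) : Trk f -> Trk (fun a => Nat.even (f a)).
Proof.
  intros Hf.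
  refine (trk_ext (fun a => natrec true (fun _ b => negb b) (f a)) _ _ _);
    [|trk].
  intros a; induction (f a) as [|n IH]; [reflexivity|].
  rewrite Nat.even_succ, <- Nat.negb_even; simpl; congruence.
Qed.

Hint Resolve trk_even : trk.

Lemma trk_odd {A} `{Enc A} (f : A -> nat) : Trk f -> Trk (fun a => Nat.odd (f a)).
Proof. intros Hf; unfold Nat.odd; trk. Qed.

Hint Resolve trk_odd : trk.

Lemma trk_div2 {A} `{Enc A} (f : A -> nat) : Trk f -> Trk (fun a => Nat.div2 (f a)).
Proof.
  intros Hf.
  refine (trk_ext (fun a => natrec 0
            (fun i y => if Nat.odd i then S y else y) (f a)) _ _ _); [|trk].
  intros a; induction (f a) as [|n IH]; [reflexivity|].
  simpl natrec; rewrite IH; clear IH.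
  pose proof (Nat.div2_odd n); pose proof (Nat.div2_odd (S n)).
  rewrite Nat.odd_succ, <- Nat.negb_odd in *; destruct (Nat.odd n); simpl Nat.b2n in *; lia.
Qed.

Lemma trk_unpair {A} `{Enc A} (f : A -> nat) : Trk f -> Trk (fun a => unpair (f a)).
Proof.
  apply trk_comp; exists (fun n => n); split; [apply rfun1, rfun_proj; lia|].
  intros k; symmetry; apply pair_unpair.
Qed.

Lemma trk_pair_code {A} `{Enc A} (f g : A -> nat) :
  Trk f -> Trk g -> Trk (fun a => Defs.pair (f a) (g a)).
Proof.
  intros Hf Hg; destruct (trk_pair f g Hf Hg) as [h Hh]; exists h; exact Hh.
Qed.

Hint Resolve trk_S trk_pred trk_add trk_sub trk_mul trk_pow trk_is_zero trk_eqb trk_leb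
  trk_negb trk_andb trk_orb trk_beqb trk_even trk_odd trk_div2 trk_unpair trk_pair_code : trk.

Lemma trk_code {A B} `{Enc A} `{Enc B} (f : A -> B) (g : nat -> nat) :
  Trk g -> (forall a, g (enc a) = enc (f a)) -> Trk f.
Proof.
  intros [h [Hh Hg]] E; exists h; split; auto; intros a; rewrite <- E; apply Hg.
Qed.

Lemma trk_cons {A B} `{Enc A} `{Enc B} (x : A -> B) (l : A -> list B) :
  Trk x -> Trk l -> Trk (fun a => x a :: l a).
Proof.
  intros Hx Hl.
  destruct (trk_pair x l Hx Hl) as [h [Rh Hh]].
  exists (fun n => S (h n)); split.
  - apply (total_recursive_comp _ _ total_recursive_S Rh).
  - intros a; rewrite Hh; reflexivity.
Qed.

Lemma trk_tl {A B} `{Enc A} `{Enc B} (l : A -> list B) : Trk l -> Trk (fun a => tl (l a)).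
Proof.
  apply trk_comp, (trk_code _ (fun n => snd (unpair (pred n)))); [trk|].
  intros [|x l']; [reflexivity|].
  unfold enc, enc_list; simpl; rewrite unpair_pair; reflexivity.
Qed.

Lemma trk_hd {A B} `{Enc A} `{Enc B} (d : B) (l : A -> list B) : Trk l -> Trk (fun a => hd d (l a)).
Proof.
  apply trk_comp, (trk_code _ (fun n => if n =? 0 then enc d else fst (unpair (pred n)))); [trk|].
  intros [|x l']; [reflexivity|].
  unfold enc, enc_list; simpl; rewrite unpair_pair; reflexivity.
Qed.

Lemma length_le_enc {B} `{Enc B} (l : list B) : length l <= enc l.
Proof.
  induction l as [|x l IH]; [apply le_n|]; simpl length.
  change (enc (x :: l)) with (S (Defs.pair (enc x) (enc l))).
  pose proof (pair_ge (enc x) (enc l)); lia.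
Qed.

(** A fold becomes a counted iteration on the remaining code and the accumulator. The code of the
    list itself is the number of rounds: it bounds the length, and [step] is idle once the list is
    empty. *)
Lemma trk_fold_left {A B C} `{Enc A} `{Enc B} `{Enc C}
  (f : A -> B -> C -> B) (l : A -> list C) (b : A -> B) :
  Trk (fun p : A * (B * C) => f (fst p) (fst (snd p)) (snd (snd p))) -> Trk l -> Trk b ->
  Trk (fun a => fold_left (f a) (l a) (b a)).
Proof.
  intros [h [Rh Hh]] Hl Hb.
  set (step := fun n (st : nat * nat) =>
         if fst st =? 0 then st else
           (snd (unpair (pred (fst st))),
            h (Defs.pair n (Defs.pair (snd st) (fst (unpair (pred (fst st)))))))).
  apply (trk_comp (fun p : A * (list C * B) => fold_left (f (fst p)) (fst (snd p)) (snd (snd p)))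
           (fun a => (a, (l a, b a)))); [|trk].
  apply (trk_code _ (fun n => snd (natrec
           (unpair (snd (unpair n)))
           (fun _ st => step (fst (unpair n)) st)
           (fst (unpair (snd (unpair n))))))).
  - apply trk_snd, trk_natrec; [trk| |trk].
    unfold step; apply trk_if; [trk|trk|].
    apply trk_pair; [trk|]; apply (trk_total _ _ Rh); trk.
  - intros [a [l' b']].
    change (enc (a, (l', b'))) with (Defs.pair (enc a) (Defs.pair (enc l') (enc b'))).
    rewrite !unpair_pair; cbn [fst snd]; rewrite !unpair_pair; cbn [fst snd].
    enough (E : forall N, length l' <= N ->
       snd (natrec (enc l', enc b')
              (fun _ st => step (enc a) st) N) = enc (fold_left (f a) l' b'))
      by (apply E, length_le_enc).
    clear Hl Hb; revert b'; induction l' as [|x l' IH]; intros b' N HN.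
    + change (fold_left (f a) [] b') with b'.
      enough (E : natrec (0, enc b')
                    (fun _ st => step (enc a) st) N = (0, enc b')) by (exact (f_equal snd E)).
      clear HN; induction N as [|N IHN]; [reflexivity|]; simpl; rewrite IHN; reflexivity.
    + destruct N as [|N]; [simpl in HN; lia|].
      assert (Hsw : forall s, natrec s
                  (fun _ st => step (enc a) st) (S N) =
                natrec (step (enc a) s)
                  (fun _ st => step (enc a) st) N).
      { intros s; clear; induction N as [|N IHN]; [reflexivity|].
        simpl; simpl in IHN; rewrite IHN; reflexivity. }
      rewrite Hsw.
      replace (step (enc a) (enc (x :: l'), enc b')) with (enc l', enc (f a b' x)).
      * apply IH; simpl in HN; lia.
      * unfold step; cbn [fst snd].
        change (enc (x :: l')) with (S (Defs.pair (enc x) (enc l'))).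
        cbn [Nat.eqb pred]; rewrite !unpair_pair; cbn [fst snd].
        f_equal; symmetry; exact (Hh (a, (b', x))).
Qed.

Hint Resolve trk_cons trk_tl trk_hd trk_fold_left : trk.

Lemma trk_rev {A B} `{Enc A} `{Enc B} (l : A -> list B) : Trk l -> Trk (fun a => rev (l a)).
Proof.
  intros Hl; refine (trk_ext (fun a => fold_left (fun acc x => x :: acc) (l a) []) _ _ _); [|trk].
  intros a; rewrite <- fold_left_rev_right, <- (rev_involutive (l a)) at 1.
  rewrite !rev_involutive; induction (rev (l a)); simpl; congruence.
Qed.

Hint Resolve trk_rev : trk.

Lemma trk_fold_right {A B C} `{Enc A} `{Enc B} `{Enc C}
  (f : A -> C -> B -> B) (l : A -> list C) (b : A -> B) :
  Trk (fun p : A * (B * C) => f (fst p) (snd (snd p)) (fst (snd p))) -> Trk l -> Trk b ->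
  Trk (fun a => fold_right (f a) (b a) (l a)).
Proof.
  intros Hf Hl Hb.
  refine (trk_ext (fun a => fold_left (fun acc x => f a x acc) (rev (l a)) (b a)) _ _ _); [|trk].
  intros a; rewrite <- fold_left_rev_right, rev_involutive; reflexivity.
Qed.

Hint Resolve trk_rev trk_fold_right : trk.

Lemma trk_reindex {A B C D} `{Enc A} `{Enc B} `{Enc C} `{Enc D} (h : A -> B -> C)
  (f : D -> A) (g : D -> B) :
  Trk (fun p : A * B => h (fst p) (snd p)) -> Trk f -> Trk g -> Trk (fun d => h (f d) (g d)).
Proof.
  intros Hh Hf Hg; exact (trk_comp _ (fun d => (f d, g d)) Hh (trk_pair f g Hf Hg)).
Qed.

Lemma trk_map {A B C} `{Enc A} `{Enc B} `{Enc C} (f : A -> C -> B) (l : A -> list C) :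
  Trk (fun p : A * C => f (fst p) (snd p)) -> Trk l -> Trk (fun a => map (f a) (l a)).
Proof.
  intros Hf Hl.
  refine (trk_ext (fun a => fold_right (fun x acc => f a x :: acc) [] (l a)) _ _ _).
  - intros a; induction (l a) as [|x k IH]; simpl; [|rewrite IH]; reflexivity.
  - apply trk_fold_right; [|trk|trk]; apply trk_cons; [apply (trk_reindex f)|]; trk.
Qed.

Lemma trk_filter {A C} `{Enc A} `{Enc C} (f : A -> C -> bool) (l : A -> list C) :
  Trk (fun p : A * C => f (fst p) (snd p)) -> Trk l -> Trk (fun a => filter (f a) (l a)).
Proof.
  intros Hf Hl.
  refine (trk_ext (fun a => fold_right (fun x acc => if f a x then x :: acc else acc)
                              [] (l a)) _ _ _).
  - intros a; induction (l a) as [|x k IH]; simpl; [|rewrite IH]; reflexivity.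
  - apply trk_fold_right; [|trk|trk]; apply trk_if; [apply (trk_reindex f)| |]; trk.
Qed.

Lemma trk_existsb {A C} `{Enc A} `{Enc C} (f : A -> C -> bool) (l : A -> list C) :
  Trk (fun p : A * C => f (fst p) (snd p)) -> Trk l -> Trk (fun a => existsb (f a) (l a)).
Proof.
  intros Hf Hl.
  refine (trk_ext (fun a => fold_right (fun x acc => f a x || acc)%bool false (l a)) _ _ _).
  - intros a; induction (l a) as [|x k IH]; simpl; [|rewrite IH]; reflexivity.
  - apply trk_fold_right; [|trk|trk]; apply trk_orb; [apply (trk_reindex f)|]; trk.
Qed.

Lemma trk_forallb {A C} `{Enc A} `{Enc C} (f : A -> C -> bool) (l : A -> list C) :
  Trk (fun p : A * C => f (fst p) (snd p)) -> Trk l -> Trk (fun a => forallb (f a) (l a)).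
Proof.
  intros Hf Hl.
  refine (trk_ext (fun a => fold_right (fun x acc => f a x && acc)%bool true (l a)) _ _ _).
  - intros a; induction (l a) as [|x k IH]; simpl; [|rewrite IH]; reflexivity.
  - apply trk_fold_right; [|trk|trk]; apply trk_andb; [apply (trk_reindex f)|]; trk.
Qed.

Lemma trk_app {A C} `{Enc A} `{Enc C} (l m : A -> list C) : Trk l -> Trk m -> Trk (fun a => l a ++ m a).
Proof.
  intros Hl Hm; refine (trk_ext (fun a => fold_right cons (m a) (l a)) _ _ _); [|trk].
  intros a; induction (l a) as [|x k IH]; simpl; [|rewrite IH]; reflexivity.
Qed.

Lemma trk_length {A C} `{Enc A} `{Enc C} (l : A -> list C) : Trk l -> Trk (fun a => length (l a)).
Proof.
  intros Hl; refine (trk_ext (fun a => fold_right (fun _ n => S n) 0 (l a)) _ _ _); [|trk].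
  intros a; induction (l a) as [|x k IH]; simpl; [|rewrite IH]; reflexivity.
Qed.

Lemma trk_skipn {A C} `{Enc A} `{Enc C} (n : A -> nat) (l : A -> list C) :
  Trk n -> Trk l -> Trk (fun a => skipn (n a) (l a)).
Proof.
  intros Hn Hl; refine (trk_ext (fun a => natrec (l a)
                                   (fun _ m => tl m) (n a)) _ _ _); [|trk].
  intros a; clear; generalize (l a); induction (n a) as [|k IH]; intros m; [reflexivity|].
  simpl; rewrite IH; clear; revert m; induction k as [|k IH]; intros [|x m]; auto.
  exact (IH m).
Qed.

Hint Resolve trk_skipn : trk.

Lemma trk_nth {A C} `{Enc A} `{Enc C} (n : A -> nat) (l : A -> list C) (d : C) :
  Trk n -> Trk l -> Trk (fun a => nth (n a) (l a) d).
Proof.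
  intros Hn Hl; refine (trk_ext (fun a => hd d (skipn (n a) (l a))) _ _ _); [|trk].
  intros a; generalize (l a); clear; induction (n a) as [|k IH]; intros [|x m]; auto.
  exact (IH m).
Qed.

Hint Resolve trk_map trk_filter trk_existsb trk_forallb trk_app trk_length trk_skipn trk_nth : trk.

Lemma trk_seq {A} `{Enc A} (s n : A -> nat) :
  Trk s -> Trk n -> Trk (fun a => seq (s a) (n a)).
Proof.
  intros Hs Hn; refine (trk_ext (fun a => map (fun i => s a + i)
     (natrec [] (fun i l => l ++ [i]) (n a))) _ _ _).
  - intros a; generalize (s a); intros k; induction (n a) as [|m IH]; [reflexivity|].
    rewrite seq_S; simpl; rewrite map_app; simpl; congruence.
  - apply trk_map; [|trk]; apply trk_add; [apply (trk_comp s fst Hs)|]; trk.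
Qed.

Hint Resolve trk_seq : trk.

Lemma trk_prefix {A B} `{Enc A} `{Enc B} (f : A -> nat -> B) (n : A -> nat) :
  Trk (fun p : A * nat => f (fst p) (snd p)) -> Trk n -> Trk (fun a => prefix (f a) (n a)).
Proof. intros Hf Hn; unfold prefix; trk. Qed.

Hint Resolve trk_prefix : trk.

Lemma natrec_shift {B} (s : B -> B) b n :
  natrec b (fun _ => s) (S n) = natrec (s b) (fun _ => s) n.
Proof.
  induction n as [|n IH]; [reflexivity|]; simpl in *; rewrite IH; reflexivity.
Qed.

Lemma trk_wordof {A} `{Enc A} (f : A -> nat) : Trk f -> Trk (fun a => wordof (f a)).
Proof.
  intros Hf.
  (* Each round peels off one letter, the first letter first, so the word accumulates in reverse; as
     in [wordof], the number is its own fuel. *)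
  set (step := fun st : nat * list bool => if fst st =? 0 then st else
     (Nat.div2 (pred (fst st)), Nat.odd (pred (fst st)) :: snd st)).
  refine (trk_ext (fun a => rev (snd (natrec (f a, []) (fun _ st => step st) (f a)))) _ _ _);
    [|unfold step; trk].
  intros a; unfold wordof; generalize (f a); intros n.
  enough (E : forall m k l, snd (natrec (k, l) (fun _ st => step st) m) = rev (word_aux m k) ++ l)
    by (rewrite E, app_nil_r; apply rev_involutive).
  clear n; induction m as [|m IH]; intros k l; [reflexivity|].
  rewrite (natrec_shift step); destruct k as [|k].
  - change (step (0, l)) with (0, l); rewrite IH; destruct m; reflexivity.
  - change (step (S k, l)) with (Nat.div2 k, Nat.odd k :: l).
    rewrite IH; simpl; rewrite <- app_assoc; reflexivity.
Qed.

(** * Binary words, prefixes and cylinders *)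

Lemma codeword_word_aux f n : n <= f -> codeword (word_aux f n) = n.
Proof.
  revert n; induction f as [|f IH]; intros [|k] Hk; try reflexivity; try lia.
  simpl word_aux; pose proof (Nat.div2_odd k) as E; pose proof (Nat.le_div2 k).
  assert (Hd : Nat.div2 k <= f) by (destruct k; [simpl; lia|]; pose proof (Nat.lt_div2 (S k)); lia).
  destruct (Nat.odd k); simpl codeword; rewrite (IH _ Hd); simpl Nat.b2n in E; lia.
Qed.

Lemma codeword_wordof n : codeword (wordof n) = n.
Proof. apply codeword_word_aux, le_n. Qed.

Lemma codeword_inj u w : codeword u = codeword w -> u = w.
Proof.
  revert w; induction u as [|[] u IH]; intros [|[] w] E; simpl in E; try lia; auto;
    f_equal; apply IH; lia.
Qed.

Lemma wordof_codeword w : wordof (codeword w) = w.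
Proof. apply codeword_inj, codeword_wordof. Qed.

Lemma length_le_codeword w : length w <= codeword w.
Proof. induction w as [|[] w IH]; simpl; lia. Qed.

Definition words (s : nat) : list (list bool) :=
  natrec [[]] (fun _ l => map (cons false) l ++ map (cons true) l) s.

Lemma trk_words {A} `{Enc A} (f : A -> nat) : Trk f -> Trk (fun a => words (f a)).
Proof. intros Hf; unfold words; trk. Qed.

Lemma words_S s : words (S s) = map (cons false) (words s) ++ map (cons true) (words s).
Proof. reflexivity. Qed.

Lemma in_words s w : In w (words s) <-> length w = s.
Proof.
  revert w; induction s as [|s IH]; intros w.
  - destruct w; simpl; split; auto; try discriminate; intros [|[]]; discriminate.
  - rewrite words_S, in_app_iff, !in_map_iff; split.
    + intros [[v [<- Hv]]|[v [<- Hv]]]; simpl; f_equal; apply IH, Hv.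
    + destruct w as [|[] w]; intros E; try discriminate; injection E as E; [right|left];
        exists w; (split; [reflexivity | apply IH, E]).
Qed.

Definition prefb (u w : list bool) : bool :=
  (length u <=? length w) &&
  forallb (fun i => Bool.eqb (nth i u false) (nth i w false)) (seq 0 (length u)).

Hint Resolve trk_wordof trk_words : trk.

Lemma trk_prefb {A} `{Enc A} (f g : A -> list bool) :
  Trk f -> Trk g -> Trk (fun a => prefb (f a) (g a)).
Proof.
  intros Hf Hg; unfold prefb.
  apply (trk_reindex (fun u w : list bool => (length u <=? length w) &&
    forallb (fun i => Bool.eqb (nth i u false) (nth i w false)) (seq 0 (length u)))%bool f g); trk.
Qed.

Hint Resolve trk_prefb : trk.

Lemma prefb_spec u w :
  prefb u w = true <->
  length u <= length w /\ forall i, i < length u -> nth i u false = nth i w false.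
Proof.
  unfold prefb; rewrite Bool.andb_true_iff, Nat.leb_le, forallb_forall.
  split; intros [H1 H2]; (split; [exact H1|]); intros i Hi.
  - apply Bool.eqb_prop, H2, in_seq; lia.
  - apply in_seq in Hi; apply Bool.eqb_true_iff, H2; lia.
Qed.

Lemma prefix_length {A} (x : nat -> A) n : length (prefix x n) = n.
Proof. unfold prefix; rewrite length_map, length_seq; reflexivity. Qed.

Lemma nth_prefix {A} (x : nat -> A) n i d : i < n -> nth i (prefix x n) d = x i.
Proof.
  intros Hi; unfold prefix.
  rewrite (nth_indep _ d (x 0)) by (rewrite length_map, length_seq; exact Hi).
  rewrite map_nth, seq_nth by exact Hi; reflexivity.
Qed.

Lemma prefix_ext {A} (x y : nat -> A) n : (forall i, i < n -> x i = y i) -> prefix x n = prefix y n.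
Proof. intros E; apply map_ext_in; intros i Hi%in_seq; apply E; lia. Qed.

Lemma prefix_S {A} (x : nat -> A) n : prefix x (S n) = prefix x n ++ [x n].
Proof. unfold prefix; rewrite seq_S, map_app; reflexivity. Qed.

Lemma prefix_nth {A} (w : list A) d : prefix (fun i => nth i w d) (length w) = w.
Proof.
  apply (nth_ext _ _ d d); [apply prefix_length|].
  rewrite prefix_length; intros i Hi; rewrite nth_prefix by exact Hi; reflexivity.
Qed.

Lemma in_cyl_spec u x : in_cyl u x <-> forall i, i < length u -> x i = nth i u false.
Proof.
  unfold in_cyl; split; intros E.
  - intros i Hi; rewrite <- E, nth_prefix by exact Hi; reflexivity.
  - rewrite <- (prefix_nth u false) at 2; apply prefix_ext, E.
Qed.

Lemma prefb_prefix u x n : length u <= n -> prefb u (prefix x n) = true <-> in_cyl u x.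
Proof.
  intros Hn; rewrite prefb_spec, in_cyl_spec, prefix_length; split.
  - intros [_ E] i Hi; rewrite E, nth_prefix by lia; reflexivity.
  - intros E; split; [exact Hn|]; intros i Hi; rewrite nth_prefix by lia; rewrite E; auto.
Qed.

Lemma prefb_prefix_in_cyl u x n : prefb u (prefix x n) = true -> in_cyl u x.
Proof.
  intros E; refine (proj1 (prefb_prefix u x n _) E).
  apply prefb_spec in E as [E _]; rewrite prefix_length in E; exact E.
Qed.

(** * Integers and the numbering of their codes *)

Instance enc_Z : Enc Z := fun z => Defs.pair (Z.to_nat z) (Z.to_nat (- z)).

(** Truncated subtraction in both directions yields the positive and the negative part, which make
    up the code. The ring operations on integers are then reduced to such differences. *)
Lemma trk_Z_diff {A} `{Enc A} (f g : A -> nat) :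
  Trk f -> Trk g -> Trk (fun a => Z.of_nat (f a) - Z.of_nat (g a))%Z.
Proof.
  intros Hf Hg.
  assert (Hp : Trk (fun a => (f a - g a, g a - f a))) by trk.
  destruct Hp as [h [Rh Hh]]; exists h; split; [exact Rh|]; intros a; rewrite Hh.
  unfold enc, enc_Z, enc_prod, enc, enc_nat; cbn [fst snd]; f_equal; lia.
Qed.

Lemma trk_Z_to_nat {A} `{Enc A} (f : A -> Z) : Trk f -> Trk (fun a => Z.to_nat (f a)).
Proof.
  apply trk_comp, (trk_code _ (fun n => fst (unpair n))); [trk|].
  intros z; unfold enc, enc_Z; rewrite unpair_pair; reflexivity.
Qed.

Lemma trk_Z_neg_to_nat {A} `{Enc A} (f : A -> Z) : Trk f -> Trk (fun a => Z.to_nat (- f a)).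
Proof.
  apply (trk_comp (fun z => Z.to_nat (- z))), (trk_code _ (fun n => snd (unpair n))); [trk|].
  intros z; unfold enc, enc_Z; rewrite unpair_pair; reflexivity.
Qed.

Hint Resolve trk_Z_diff trk_Z_to_nat trk_Z_neg_to_nat : trk.

Lemma trk_Z_of_nat {A} `{Enc A} (f : A -> nat) : Trk f -> Trk (fun a => Z.of_nat (f a)).
Proof.
  intros Hf; refine (trk_ext (fun a => Z.of_nat (f a) - Z.of_nat 0)%Z _ _ _); [lia|trk].
Qed.

Lemma trk_Z_opp {A} `{Enc A} (f : A -> Z) : Trk f -> Trk (fun a => - f a)%Z.
Proof.
  intros Hf; refine (trk_ext (fun a => Z.of_nat (Z.to_nat (- f a)) - Z.of_nat (Z.to_nat (f a)))%Z
    _ _ _); [lia|trk].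
Qed.

Lemma trk_Z_add {A} `{Enc A} (f g : A -> Z) : Trk f -> Trk g -> Trk (fun a => f a + g a)%Z.
Proof.
  intros Hf Hg; refine (trk_ext (fun a =>
    Z.of_nat (Z.to_nat (f a) + Z.to_nat (g a)) -
    Z.of_nat (Z.to_nat (- f a) + Z.to_nat (- g a)))%Z _ _ _); [lia|trk].
Qed.

Lemma trk_Z_mul {A} `{Enc A} (f g : A -> Z) : Trk f -> Trk g -> Trk (fun a => f a * g a)%Z.
Proof.
  intros Hf Hg; refine (trk_ext (fun a =>
    Z.of_nat (Z.to_nat (f a) * Z.to_nat (g a) + Z.to_nat (- f a) * Z.to_nat (- g a)) -
    Z.of_nat (Z.to_nat (f a) * Z.to_nat (- g a) + Z.to_nat (- f a) * Z.to_nat (g a)))%Z _ _ _);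
    [|trk].
  intros a; rewrite !Nat2Z.inj_add, !Nat2Z.inj_mul.
  set (p := Z.of_nat (Z.to_nat (f a))); set (p' := Z.of_nat (Z.to_nat (- f a))).
  set (q := Z.of_nat (Z.to_nat (g a))); set (q' := Z.of_nat (Z.to_nat (- g a))).
  replace (f a) with (p - p')%Z by lia; replace (g a) with (q - q')%Z by lia; ring.
Qed.

Lemma trk_Z_leb {A} `{Enc A} (f g : A -> Z) : Trk f -> Trk g -> Trk (fun a => f a <=? g a)%Z.
Proof.
  intros Hf Hg; refine (trk_ext (fun a =>
    Z.to_nat (f a) + Z.to_nat (- g a) <=? Z.to_nat (g a) + Z.to_nat (- f a)) _ _ _); [|trk].
  intros a; destruct (Z.leb_spec (f a) (g a)); [apply Nat.leb_le | apply Nat.leb_gt]; lia.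
Qed.

Hint Resolve trk_Z_of_nat trk_Z_opp trk_Z_add trk_Z_mul trk_Z_leb : trk.

Lemma trk_zigzag {A} `{Enc A} (f : A -> nat) : Trk f -> Trk (fun a => zigzag (f a)).
Proof. intros Hf; unfold zigzag; trk. Qed.

Hint Resolve trk_zigzag : trk.

(** A right inverse of [zigzag]. One of the two summands is always zero: for z >= 0 the second one,
    by truncated subtraction. *)
Definition zagzig (z : Z) : nat := 2 * Z.to_nat z + (2 * Z.to_nat (- z) - 1).

Lemma zigzag_zagzig z : zigzag (zagzig z) = z.
Proof.
  unfold zigzag, zagzig; destruct (Z.leb_spec 0 z) as [Hz|Hz].
  - replace (2 * Z.to_nat z + (2 * Z.to_nat (- z) - 1)) with (2 * Z.to_nat z) by lia.
    rewrite Nat.even_mul, Nat.div2_double; cbn; lia.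
  - replace (2 * Z.to_nat z + (2 * Z.to_nat (- z) - 1))
      with (S (2 * (Z.to_nat (- z) - 1))) by lia.
    rewrite Nat.even_succ, Nat.odd_mul.
    replace (S (S (2 * (Z.to_nat (- z) - 1)))) with (2 * Z.to_nat (- z)) by lia.
    rewrite Nat.div2_double; cbn; lia.
Qed.

Lemma trk_zagzig {A} `{Enc A} (f : A -> Z) : Trk f -> Trk (fun a => zagzig (f a)).
Proof. intros Hf; unfold zagzig; trk. Qed.

Hint Resolve trk_zagzig : trk.

(** * Type-2 computability and strong Weihrauch reductions *)

Lemma enc_list_nat (l : list nat) : enc l = code_list l.
Proof. unfold enc, enc_list, enc, enc_nat; rewrite map_id; reflexivity. Qed.

Lemma computable_intro (h : nat -> list nat -> nat) (F : pfun) :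
  Trk (fun e : nat * list nat => h (fst e) (snd e)) ->
  (forall p q, F p q -> forall k,
     (exists n, h k (prefix p n) = S (q k)) /\
     (forall n, h k (prefix p n) = 0 \/ h k (prefix p n) = S (q k))) ->
  computable F.
Proof.
  intros [g [Rg Hg]] HF; exists g; split; [exact Rg|]; intros p q Hpq k.
  assert (E : forall n, g (Defs.pair k (code_list (prefix p n))) = h k (prefix p n)).
  { intros n; rewrite <- enc_list_nat; exact (Hg (k, prefix p n)). }
  destruct (HF p q Hpq k) as [[n Hn] Ha]; split.
  - exists n; rewrite E; exact Hn.
  - intros m; rewrite E; apply Ha.
Qed.

Lemma computable_elim (F : pfun) : computable F ->
  exists h : nat -> list nat -> nat,
    Trk (fun e : nat * list nat => h (fst e) (snd e)) /\
    forall p q, F p q -> forall k,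
     (exists n, h k (prefix p n) = S (q k)) /\
     (forall n, h k (prefix p n) = 0 \/ h k (prefix p n) = S (q k)).
Proof.
  intros [g [Rg Hg]]; exists (fun k l => g (Defs.pair k (code_list l))); split.
  - exists g; split; [exact Rg|]; intros [k l].
    unfold enc at 1, enc_prod; cbn [fst snd]; rewrite enc_list_nat; reflexivity.
  - exact Hg.
Qed.

Lemma computable_functional F p q q' : computable F -> F p q -> F p q' -> q = q'.
Proof.
  intros [h [_ Hh]] Hq Hq'; apply functional_extensionality; intros k.
  destruct (Hh p q Hq k) as [[n Hn] _]; destruct (Hh p q' Hq' k) as [_ Ha].
  destruct (Ha n); congruence.
Qed.

Definition pointwise (V : nat -> Baire -> nat) : pfun :=
  fun p q => forall k, q k = V k p.

(** [N] is a modulus of continuity that does not depend on the input: the algorithm waits until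
    [N k] values are known and then answers. Padding the finite prefix with 0 is harmless by
    locality. *)
Lemma computable_pointwise (N : nat -> nat) (V : nat -> (nat -> nat) -> nat) :
  Trk N -> Trk (fun e : nat * list nat => V (fst e) (fun i => nth i (snd e) 0)) ->
  (forall k p p', (forall i, i < N k -> p i = p' i) -> V k p = V k p') ->
  computable (pointwise V).
Proof.
  intros HN HV Hloc.
  apply (computable_intro (fun k l => if N k <=? length l then S (V k (fun i => nth i l 0)) else 0)).
  - apply trk_if; [|apply trk_S, HV|trk].
    apply trk_leb; [apply (trk_comp N fst HN)|]; trk.
  - intros p q Hq k.
    assert (E : forall n, N k <= n -> V k (fun i => nth i (prefix p n) 0) = q k).
    { intros n Hn; rewrite (Hq k); apply Hloc; intros i Hi; apply nth_prefix; lia. }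
    split.
    + exists (N k); rewrite prefix_length, Nat.leb_refl, E; auto.
    + intros n; rewrite prefix_length; destruct (Nat.leb_spec (N k) n); auto.
Qed.

Definition answer (l : list nat) : nat := hd 0 (filter (fun a => negb (a =? 0)) l).

Lemma trk_answer {A} `{Enc A} (l : A -> list nat) : Trk l -> Trk (fun a => answer (l a)).
Proof. intros Hl; unfold answer; trk. Qed.

Lemma answer_correct l v :
  (forall a, In a l -> a = 0 \/ a = S v) ->
  (answer l = 0 \/ answer l = S v) /\ (In (S v) l -> answer l = S v).
Proof.
  intros Hl; unfold answer; induction l as [|a l IH]; [split; [auto|intros []]|].
  destruct (Hl a (or_introl eq_refl)) as [->| ->]; simpl; [|auto].
  destruct IH as [IH1 IH2]; [intros; apply Hl; right; auto|].
  split; [exact IH1|]; intros [E|Hi]; [discriminate|auto].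
Qed.

(** An algorithm may answer on some prefix and be silent again on longer ones, so every shorter
    prefix is tried as well. [look] finds intermediate values in this way, and [h] runs the second
    algorithm on every initial segment of values found so far. All nonzero answers agree, so taking
    the first one is safe. *)
Lemma computable_comp F E :
  computable F -> computable E -> computable (fun p r => exists q, E p q /\ F q r).
Proof.
  intros [hF [RF HF]]%computable_elim [hE [RE HE]]%computable_elim.
  set (look := fun j l => answer (map (fun n => hE j (prefix (fun i => nth i l 0) n))
                                    (seq 0 (S (length l))))).
  set (h := fun k l => answer (map (fun m =>
        if forallb (fun j => negb (look j l =? 0)) (seq 0 m)
        then hF k (prefix (fun j => pred (look j l)) m) else 0) (seq 0 (S (length l))))).
  assert (Rlook : Trk (fun e : nat * list nat => look (fst e) (snd e))).
  { unfold look; apply trk_answer, trk_map; [|trk].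
    apply (trk_reindex hE _ _ RE); trk. }
  apply (computable_intro h).
  - unfold h; apply trk_answer, trk_map; [|trk].
    apply trk_if; [| |trk].
    + apply trk_forallb; [|trk].
      apply trk_negb, trk_is_zero, (trk_reindex look _ _ Rlook); trk.
    + apply (trk_reindex hF _ _ RF); [trk|].
      apply trk_prefix; [|trk]; apply trk_pred, (trk_reindex look _ _ Rlook); trk.
  - intros p r [q [Hpq Hqr]] k.
    assert (Hlook : forall j n, (look j (prefix p n) = 0 \/ look j (prefix p n) = S (q j)) /\
        forall n0, n0 <= n -> hE j (prefix p n0) = S (q j) -> look j (prefix p n) = S (q j)).
    { intros j n; unfold look.
      assert (Hpp : forall m, m <= n -> prefix (fun i => nth i (prefix p n) 0) m = prefix p m).
      { intros m Hm; apply prefix_ext; intros i Hi; apply nth_prefix; lia. }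
      destruct (answer_correct (map (fun m => hE j (prefix (fun i => nth i (prefix p n) 0) m))
                       (seq 0 (S (length (prefix p n))))) (q j)) as [H1 H2].
      { intros a [m [<- Hm%in_seq]]%in_map_iff; rewrite prefix_length in Hm.
        rewrite Hpp by lia; apply (HE p q Hpq). }
      split; [exact H1|]; intros n0 Hn0 E0; apply H2, in_map_iff; exists n0; split.
      - rewrite Hpp; auto.
      - apply in_seq; rewrite prefix_length; lia. }
    assert (Hh : forall n, (h k (prefix p n) = 0 \/ h k (prefix p n) = S (r k)) /\
        forall m, m <= n -> (forall j, j < m -> look j (prefix p n) = S (q j)) ->
          hF k (prefix q m) = S (r k) -> h k (prefix p n) = S (r k)).
    { intros n; unfold h.
      match goal with |- context [answer ?l] =>
        destruct (answer_correct l (r k)) as [H1 H2] end.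
      { intros a [m [<- Hm%in_seq]]%in_map_iff.
        destruct (forallb _ _) eqn:Ea; [|auto].
        rewrite forallb_forall in Ea.
        rewrite (prefix_ext _ q); [apply (HF q r Hqr)|].
        intros j Hj; assert (Hin : In j (seq 0 m)) by (apply in_seq; lia); specialize (Ea j Hin).
        destruct (Hlook j n) as [[E0|E0] _]; rewrite E0 in *; [discriminate|reflexivity]. }
      split; [exact H1|]; intros m Hm Hl Ea; apply H2, in_map_iff; exists m; split.
      - assert (Ef : forallb (fun j => negb (look j (prefix p n) =? 0)) (seq 0 m) = true).
        { apply forallb_forall; intros j Hj%in_seq; rewrite Hl by lia; reflexivity. }
        rewrite Ef, <- Ea; f_equal; apply prefix_ext; intros j Hj; rewrite Hl by lia; reflexivity.
      - apply in_seq; rewrite prefix_length; lia. }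
    split; [|apply Hh].
    destruct (HF q r Hqr k) as [[m Hm] _].
    (* The finitely many intermediate values that the second algorithm reads all appear below one
       bound, and [look] never loses a value once found. *)
    assert (HN : exists N, forall j, j < m -> exists n0, n0 <= N /\ hE j (prefix p n0) = S (q j)).
    { clear - HE Hpq; induction m as [|m [N IH]]; [exists 0; lia|].
      destruct (HE p q Hpq m) as [[n Hn] _]; exists (N + n); intros j Hj.
      destruct (Nat.eq_dec j m) as [->|Hne]; [exists n; split; [lia|exact Hn]|].
      destruct (IH j ltac:(lia)) as [n0 [Hn0 E0]]; exists n0; split; [lia|exact E0]. }
    destruct HN as [N HN]; exists (N + m); apply (Hh (N + m)) with (m := m); [lia| |exact Hm].
    intros j Hj; destruct (HN j Hj) as [n0 [Hn0 E0]].
    apply (Hlook j (N + m)) with n0; [lia|exact E0].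
Qed.

Lemma sW_le_trans {X Y Z W U V} (f : mvf X Y) (g : mvf Z W) (h : mvf U V) :
  sW_le f g -> sW_le g h -> sW_le f h.
Proof.
  intros [H1 [K1 [CH1 [CK1 R1]]]] [H2 [K2 [CH2 [CK2 R2]]]].
  exists (fun p r => exists q, H2 p q /\ H1 q r), (fun p r => exists q, K1 p q /\ K2 q r).
  split; [exact (computable_comp _ _ CH1 CH2)|].
  split; [exact (computable_comp _ _ CK2 CK1)|].
  intros G FG RG p x Hp Hx.
  (* The first reduction is applied to the realizer [pcomp H2 G K2] of [g], which it accepts only if
     it is single-valued. *)
  assert (FG' : functional (pcomp H2 G K2)).
  { intros a b b' [c [d [Hc [Hd Hb]]]] [c' [d' [Hc' [Hd' Hb']]]] n.
    pose proof (computable_functional _ _ _ _ CK2 Hc Hc') as <-.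
    pose proof (functional_extensionality _ _ (FG _ _ _ Hd Hd')) as <-.
    rewrite (computable_functional _ _ _ _ CH2 Hb Hb'); reflexivity. }
  destruct (R1 _ FG' (R2 G FG RG) p x Hp Hx) as [q [Hq Hall]].
  assert (E : forall q', pcomp (fun p r => exists q, H2 p q /\ H1 q r) G
                (fun p r => exists q, K1 p q /\ K2 q r) p q' <->
              pcomp H1 (pcomp H2 G K2) K1 p q').
  { intros q'; unfold pcomp; split.
    - intros [a [b [[c [Hc Ha]] [Hb [d [Hd Hq']]]]]]; eauto 10.
    - intros [a [b [Ha [[c [d [Hc [Hd Hb]]]] Hq']]]]; eauto 10. }
  exists q; split; [apply E, Hq|]; intros q' Hq'; apply Hall, E, Hq'.
Qed.

(** A realizer [G] matters only through its value at the one name [p'], so it can be replaced by an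
    arbitrary name [q] of an arbitrary solution. [H] is given [q] and not [p], as strong
    reducibility demands. That computable maps are single-valued settles all other runs of the
    composition. *)
Lemma sW_le_intro {X Y Z W} (f : mvf X Y) (g : mvf Z W) (H K : pfun) :
  computable H -> computable K ->
  (forall p x, rep X p x -> (exists y, f x y) ->
     exists p' z, K p p' /\ rep Z p' z /\ (exists w, g z w) /\
       forall q w, rep W q w -> g z w -> exists r y, H q r /\ rep Y r y /\ f x y) ->
  sW_le f g.
Proof.
  intros CH CK HK; exists H, K; split; [exact CH|]; split; [exact CK|].
  intros G FG RG p x Hp Hx.
  destruct (HK p x Hp Hx) as [p' [z [HKp [Hz [Hw Hback]]]]].
  destruct (RG p' z Hz Hw) as [q [Hq Hall]].
  destruct (Hall q Hq) as [w [Hqw Hgw]].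
  destruct (Hback q w Hqw Hgw) as [r [y [Hr _]]].
  exists r; split; [exists p', q; auto|].
  intros r' [p'' [q' [HKp' [Hq' Hr']]]].
  pose proof (computable_functional _ _ _ _ CK HKp HKp') as <-.
  destruct (Hall q' Hq') as [w' [Hqw' Hgw']].
  destruct (Hback q' w' Hqw' Hgw') as [r2 [y' [Hr2 [Hy' Hf]]]].
  pose proof (computable_functional _ _ _ _ CH Hr2 Hr') as <-; eauto.
Qed.

(** * Reductions between closed sets and trees *)

Lemma computable_id : computable (pointwise (fun k p => p k)).
Proof.
  apply (computable_pointwise S); [trk|trk|]; intros k p p' E; apply E; lia.
Qed.

Lemma basic_NC_pair m j mx :
  basic_NC (Defs.pair m j) mx <-> fst mx = m /\ in_cyl (wordof j) (snd mx).
Proof. unfold basic_NC; rewrite unpair_pair; reflexivity. Qed.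

(** The cylinder of every word missing from the tree is enumerated. The translation acts on each
    column entry by entry, so it preserves eventual constancy, and columns that name no tree do no
    harm. *)
Lemma WWKL_le_PC_C : sW_le (djump WWKL) (djump PC_C).
Proof.
  set (V := fun k (p : Baire) => if p k =? 0 then S (snd (unpair k)) else 0).
  apply (sW_le_intro _ _ (pointwise (fun k p => p k)) (pointwise V)).
  - apply computable_id.
  - apply (computable_pointwise S); [trk|unfold V; trk|].
    intros k p p' E; unfold V; rewrite E by lia; reflexivity.
  - intros p T [p0 [[N [Hc Hl]] [HT [H01 Hp0]]]] [x [HnT Hx]].
    exists (fun k => V k p), (paths T); split; [intros k; reflexivity|]; split; [|split].
    + assert (HV : forall i j, column (fun k => V k p) i j =
                     if column p i j =? 0 then S j else 0).
      { intros i j; unfold column, V; rewrite unpair_pair; reflexivity. }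
      exists (fun j => if p0 j =? 0 then S j else 0); split.
      * exists N; split.
        -- intros i Hi j; rewrite !HV, Hc by exact Hi; reflexivity.
        -- intros j; rewrite HV, Hl; reflexivity.
      * intros y; split.
        -- intros Hy [n [k [E Hb]]]; unfold basic_C, in_cyl in Hb.
           destruct (Nat.eqb_spec (p0 n) 0) as [E0|]; [injection E as <-|discriminate].
           specialize (Hy (length (wordof n))); rewrite Hb in Hy.
           apply Hp0 in Hy; rewrite codeword_wordof in Hy; congruence.
        -- intros Hy n; apply Hp0.
           destruct (H01 (codeword (prefix y n))) as [E|E]; [exfalso|exact E].
           apply Hy; exists (codeword (prefix y n)), (codeword (prefix y n)).
           rewrite E; split; [reflexivity|].
           unfold basic_C, in_cyl; rewrite wordof_codeword, prefix_length; reflexivity.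
    + exists x; split; [exact HnT|exact Hx].
    + intros q w Hq [_ Hw]; exists q, w; split; [intros k; reflexivity|]; split; [exact Hq|].
      split; [exact HnT|exact Hw].
Qed.

(** Section [n] of the closed set is the [n]-th approximation, and is erased as soon as
    some later approximation is seen to differ from it. *)
Lemma PC_C_le_PC_NC : sW_le (djump PC_C) PC_NC.
Proof.
  (* Position <n,<i,j>> acts on section n. For i = n it copies item j of version n; for i > n it
     compares versions n and i at j and, if they differ, removes the whole section, since word
     number 0 is the empty word. *)
  set (V := fun u (p : Baire) =>
    let n := fst (unpair u) in
    let i := fst (unpair (snd (unpair u))) in
    let j := snd (unpair (snd (unpair u))) in
    if i =? n then
      if p (Defs.pair n j) =? 0 then 0 else S (Defs.pair n (pred (p (Defs.pair n j))))
    else if ((n <=? i) && negb (p (Defs.pair n j) =? p (Defs.pair i j)))%bool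
    then S (Defs.pair n 0) else 0).
  (* The section number is dropped on the way back: every surviving section is the limit set. *)
  apply (sW_le_intro _ _ (pointwise (fun k p => p (S (2 * k)))) (pointwise V)).
  - apply (computable_pointwise (fun k => S (S (2 * k)))); [trk|trk|].
    intros k p p' E; apply E; lia.
  - apply (computable_pointwise (fun u =>
      S (Defs.pair (fst (unpair u)) (snd (unpair (snd (unpair u)))) +
         Defs.pair (fst (unpair (snd (unpair u)))) (snd (unpair (snd (unpair u))))))).
    + trk.
    + unfold V; trk.
    + intros u p p' E; unfold V; rewrite !E by lia; reflexivity.
  - intros p A [p0 [[N [Hc Hl]] Hp0]] [x [HnA Hx]].
    set (A' := fun mx : nat * (nat -> bool) =>
           (forall i, fst mx <= i -> forall j, column p i j = column p (fst mx) j) /\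
           A (snd mx)).
    (* A version that no later one contradicts agrees with those beyond [N], hence with the limit
       name, even if n < N. *)
    assert (Hcol : forall n, (forall i, n <= i -> forall j, column p i j = column p n j) ->
                     forall j, column p n j = p0 j).
    { intros n Hn j; rewrite Hl, <- (Hn (max n N)) by lia; apply Hc; lia. }
    assert (HVp : forall n i j, V (Defs.pair n (Defs.pair i j)) p =
      if i =? n then if column p n j =? 0 then 0 else S (Defs.pair n (pred (column p n j)))
      else if ((n <=? i) && negb (column p n j =? column p i j))%bool
           then S (Defs.pair n 0) else 0).
    { intros n i j; unfold V, column; rewrite !unpair_pair; cbn [fst snd];
        rewrite !unpair_pair; reflexivity. }
    exists (fun u => V u p), A'; split; [intros k; reflexivity|]; split; [|split].
    + intros [n y]; unfold A'; cbn [fst snd]; split.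
      * intros [Hn Hy] [u [k [E Hb]]]; revert E; cbn beta.
        rewrite <- (pair_unpair u), <- (pair_unpair (snd (unpair u))), HVp.
        set (m := fst (unpair u)); set (i := fst _); set (j := snd _).
        destruct (Nat.eqb_spec i m) as [_|Hne].
        -- destruct (Nat.eqb_spec (column p m j) 0) as [|E0]; [discriminate|].
           intros E; injection E as <-; apply basic_NC_pair in Hb as [Em Hb]; cbn in Em, Hb.
           subst n; apply (proj1 (Hp0 y) Hy).
           exists j, (pred (column p m j)); split; [rewrite <- (Hcol m Hn j); lia|exact Hb].
        -- destruct (Nat.leb_spec m i); [|discriminate].
           destruct (Nat.eqb_spec (column p m j) (column p i j)) as [|E0]; [discriminate|].
           intros E; injection E as <-; apply basic_NC_pair in Hb as [Em _]; cbn in Em.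
           subst n; rewrite (Hn i) in E0; auto.
      * intros Hno.
        assert (Hn : forall i, n <= i -> forall j, column p i j = column p n j).
        { intros i Hi j; destruct (Nat.eq_dec i n) as [->|Hne]; [reflexivity|].
          apply NNPP; intros Ene; apply Hno.
          exists (Defs.pair n (Defs.pair i j)), (Defs.pair n 0); rewrite HVp.
          rewrite (proj2 (Nat.eqb_neq _ _) Hne), (proj2 (Nat.leb_le _ _) Hi).
          rewrite (proj2 (Nat.eqb_neq (column p n j) _)) by auto.
          split; [reflexivity|]; apply basic_NC_pair; split; reflexivity. }
        split; [exact Hn|]; apply Hp0; intros [j [k [E Hb]]]; apply Hno.
        exists (Defs.pair n (Defs.pair n j)), (Defs.pair n k).
        rewrite HVp, Nat.eqb_refl, (Hcol n Hn), E; split; [reflexivity|].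
        apply basic_NC_pair; split; [reflexivity|exact Hb].
    + exists (N, x); split; [|split; [exact Hc|exact Hx]].
      (* Section [N] of [A'] is all of [A], so a cover of [A'] covers [A] after its section numbers
         are forgotten. *)
      intros Hnull; apply HnA; intros eps He; destruct (Hnull eps He) as [cs [Hcov Hsum]].
      exists (fun i => snd (cs i)); split; [|exact Hsum].
      intros y Hy; destruct (Hcov (N, y)) as [i [_ Hi]]; [split; [exact Hc|exact Hy]|].
      exists i; exact Hi.
    + intros q [m y] [_ Hq] [_ [_ Hy]]; exists (fun k => q (S (2 * k))), y.
      split; [intros k; reflexivity|]; split; [exact Hq|]; split; [exact HnA|exact Hy].
Qed.

(** * Coverings and binary trees *)

Open Scope R_scope.

(** Sums over arbitrary lists; [partial_sum a N] is [lsum a (seq 0 N)] by conversion. *)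
Definition lsum {T} (f : T -> R) (l : list T) : R := fold_right Rplus 0 (map f l).

Lemma lsum_cons {T} (f : T -> R) x l : lsum f (x :: l) = f x + lsum f l.
Proof. reflexivity. Qed.

Lemma lsum_app {T} (f : T -> R) l l' : lsum f (l ++ l') = lsum f l + lsum f l'.
Proof.
  induction l as [|x l IH]; [unfold lsum; simpl; lra|].
  simpl app; rewrite !lsum_cons, IH; lra.
Qed.

Lemma lsum_map {S T} (f : T -> R) (g : S -> T) l : lsum f (map g l) = lsum (fun x => f (g x)) l.
Proof. unfold lsum; rewrite map_map; reflexivity. Qed.

Lemma lsum_le {T} (f g : T -> R) l : (forall x, In x l -> f x <= g x) -> lsum f l <= lsum g l.
Proof.
  induction l as [|x l IH]; intros H; [apply Rle_refl|].
  rewrite !lsum_cons; apply Rplus_le_compat; [apply H; left; reflexivity|].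
  apply IH; intros; apply H; right; auto.
Qed.

Lemma lsum_ext {T} (f g : T -> R) l : (forall x, In x l -> f x = g x) -> lsum f l = lsum g l.
Proof. intros H; apply Rle_antisym; apply lsum_le; intros; rewrite H; auto; apply Rle_refl. Qed.

Lemma lsum_plus {T} (f g : T -> R) l : lsum (fun x => f x + g x) l = lsum f l + lsum g l.
Proof. induction l as [|x l IH]; [unfold lsum; simpl; lra|]; rewrite !lsum_cons, IH; lra. Qed.

Lemma lsum_scal {T} (f : T -> R) c l : lsum (fun x => c * f x) l = c * lsum f l.
Proof. induction l as [|x l IH]; [unfold lsum; simpl; lra|]; rewrite !lsum_cons, IH; lra. Qed.

Lemma lsum_const {T} c (l : list T) : lsum (fun _ => c) l = INR (length l) * c.
Proof.
  induction l as [|x l IH]; [unfold lsum; simpl; lra|].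
  rewrite lsum_cons, IH; simpl length; rewrite S_INR; lra.
Qed.

Lemma lsum_nonneg {T} (f : T -> R) l : (forall x, 0 <= f x) -> 0 <= lsum f l.
Proof. intros H; induction l as [|x l IH]; [apply Rle_refl|]; rewrite lsum_cons; specialize (H x); lra. Qed.

Lemma lsum_incl {T} (f : T -> R) l l' :
  (forall x, 0 <= f x) -> NoDup l -> incl l l' -> lsum f l <= lsum f l'.
Proof.
  intros Hf Hl; revert l'; induction Hl as [|x l Hx Hl IH]; intros l' Hi.
  - apply (lsum_nonneg f l' Hf).
  - destruct (in_split x l') as [l1 [l2 ->]]; [apply Hi; left; reflexivity|].
    rewrite lsum_app, !lsum_cons.
    enough (lsum f l <= lsum f (l1 ++ l2)) by (rewrite lsum_app in *; lra).
    apply IH; intros y Hy; specialize (Hi y (or_intror Hy)).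
    rewrite in_app_iff in *; simpl in Hi.
    destruct Hi as [|[->|]]; [auto|contradiction|auto].
Qed.

Lemma lsum_prod {S T} (f : S * T -> R) l l' :
  lsum f (list_prod l l') = lsum (fun x => lsum (fun y => f (x, y)) l') l.
Proof.
  induction l as [|x l IH]; [reflexivity|].
  simpl list_prod; rewrite lsum_app, lsum_cons, IH, lsum_map; reflexivity.
Qed.

Lemma lsum_seq_S f n : lsum f (seq 0 (S n)) = lsum f (seq 0 n) + f n.
Proof. rewrite seq_S, lsum_app; unfold lsum at 2; simpl; lra. Qed.

Lemma pow_half_pos n : 0 < (/ 2) ^ n.
Proof. apply pow_lt; lra. Qed.

Lemma lsum_geom eta n : 0 <= eta -> lsum (fun k => eta * (/ 2) ^ S k) (seq 0 n) <= eta.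
Proof.
  intros He; rewrite lsum_scal.
  enough (E : lsum (fun k => (/ 2) ^ S k) (seq 0 n) = 1 - (/ 2) ^ n).
  { rewrite E; pose proof (pow_half_pos n); nra. }
  induction n as [|n IH]; [unfold lsum; simpl; lra|].
  rewrite lsum_seq_S, IH; simpl; lra.
Qed.

Lemma pow_half_small eps : 0 < eps -> exists n, (/ 2) ^ n < eps.
Proof.
  intros He; destruct (pow_lt_1_zero (/ 2)) with eps as [n Hn]; [rewrite Rabs_right; lra|lra|].
  exists n; specialize (Hn n (le_n n)).
  rewrite Rabs_right in Hn; [exact Hn|]; pose proof (pow_half_pos n); lra.
Qed.

Lemma lsum_nth_error {T} (wt : T -> R) l n : (forall c, 0 <= wt c) ->
  lsum (fun j => match nth_error l j with Some c => wt c | None => 0 end) (seq 0 n) <= lsum wt l.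
Proof.
  intros Hw; revert n; induction l as [|x l IH]; intros n.
  - rewrite (lsum_ext _ (fun _ => 0)); [rewrite lsum_const; unfold lsum; simpl; lra|].
    intros [|j] _; reflexivity.
  - destruct n as [|n]; [apply (lsum_nonneg wt (x :: l) Hw)|].
    rewrite <- cons_seq, <- seq_shift, !lsum_cons, lsum_map; simpl nth_error.
    specialize (IH n); lra.
Qed.

(** Since i + j <= <i,j>, the first n pairs are distinct elements of the n by n square, and the
    terms are nonnegative. *)
Lemma lsum_unpair g n : (forall ij, 0 <= g ij) ->
  lsum (fun k => g (unpair k)) (seq 0 n) <=
  lsum (fun i => lsum (fun j => g (i, j)) (seq 0 n)) (seq 0 n).
Proof.
  intros Hg; rewrite <- lsum_prod, <- (lsum_map g unpair).
  apply (lsum_incl g _ _ Hg).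
  - apply FinFun.Injective_map_NoDup; [|apply seq_NoDup].
    intros a b E; rewrite <- (pair_unpair a), <- (pair_unpair b), E; reflexivity.
  - intros [i j] [k [E Hk%in_seq]]%in_map_iff.
    pose proof (pair_ge (fst (unpair k)) (snd (unpair k))) as H.
    rewrite pair_unpair, E in H; cbn in H.
    apply in_prod; apply in_seq; lia.
Qed.

(** Slots left empty by the pairing function are padded with cylinders of small weight. *)
Lemma flatten_cover {T} (wt : T -> R) (L : nat -> list T) eps eta :
  (forall c, 0 <= wt c) -> (forall d, 0 < d -> exists c, wt c <= d) -> 0 < eta ->
  (forall n, lsum (fun i => lsum wt (L i)) (seq 0 n) <= eps) ->
  exists cs : nat -> T, (forall i c, In c (L i) -> exists k, cs k = c) /\
    forall n, partial_sum (fun k => wt (cs k)) n <= eps + eta.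
Proof.
  intros Hw Hsmall He HL.
  assert (Hpad : forall k, exists c, wt c <= eta * (/ 2) ^ S k).
  { intros k; apply Hsmall, Rmult_lt_0_compat; [exact He|apply pow_half_pos]. }
  set (pad := fun k => proj1_sig (constructive_indefinite_description _ (Hpad k))).
  assert (Hp : forall k, wt (pad k) <= eta * (/ 2) ^ S k) by (intros k; apply proj2_sig).
  exists (fun k => match nth_error (L (fst (unpair k))) (snd (unpair k)) with
                   | Some c => c | None => pad k end); split.
  - intros i c [j Hj]%In_nth_error; exists (Defs.pair i j).
    rewrite unpair_pair; cbn [fst snd]; rewrite Hj; reflexivity.
  - intros n.
    set (g := fun ij : nat * nat =>
           match nth_error (L (fst ij)) (snd ij) with Some c => wt c | None => 0 end).
    apply Rle_trans with (lsum (fun k => g (unpair k) + eta * (/ 2) ^ S k) (seq 0 n)).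
    + apply (lsum_le (fun k => wt _)); intros k _; unfold g; cbn beta.
      destruct (nth_error _ _); [|rewrite Rplus_0_l; apply Hp].
      pose proof (Rmult_lt_0_compat _ _ He (pow_half_pos (S k))); lra.
    + rewrite lsum_plus; apply Rplus_le_compat; [|apply lsum_geom; lra].
      eapply Rle_trans; [apply lsum_unpair|].
      { intros [i j]; unfold g; destruct (nth_error _ _); [apply Hw|apply Rle_refl]. }
      eapply Rle_trans; [|apply (HL n)].
      apply lsum_le; intros i _; apply (lsum_nth_error wt (L i) n Hw).
Qed.

(** * Counting the words on a level of a tree *)

Definition count (T : list bool -> bool) (s : nat) : nat := length (filter T (words s)).

Lemma count_S T s : count T (S s) =
  (count (fun w => T (false :: w)) s + count (fun w => T (true :: w)) s)%nat.
Proof.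
  unfold count; rewrite words_S, filter_app, length_app, !filter_map_swap, !length_map.
  reflexivity.
Qed.

Lemma count_ext T T' s : (forall w, T w = T' w) -> count T s = count T' s.
Proof. intros E; unfold count; rewrite (filter_ext _ _ E); reflexivity. Qed.

Lemma count_false s : count (fun _ => false) s = 0%nat.
Proof. unfold count; induction (words s); simpl; auto. Qed.

Lemma length_words s : INR (length (words s)) = 2 ^ s.
Proof.
  induction s as [|s IH]; [simpl; lra|].
  rewrite words_S, length_app, !length_map, plus_INR, IH; simpl; lra.
Qed.

Lemma prefb_nil w : prefb [] w = true.
Proof. reflexivity. Qed.

Lemma prefb_cons b u c w : prefb (b :: u) (c :: w) = (Bool.eqb b c && prefb u w)%bool.
Proof.
  apply Bool.eq_true_iff_eq; rewrite Bool.andb_true_iff, Bool.eqb_true_iff, !prefb_spec; simpl.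
  split.
  - intros [Hl H]; split; [apply (H 0%nat); lia|]; split; [lia|].
    intros i Hi; apply (H (S i)); lia.
  - intros [-> [Hl H]]; split; [lia|]; intros [|i] Hi; [reflexivity|apply H; lia].
Qed.

(** Only an inequality, because no word shorter than [u] extends it. *)
Lemma count_prefb u s : INR (count (prefb u) s) <= 2 ^ s * (/ 2) ^ length u.
Proof.
  revert s; induction u as [|b u IH]; intros s.
  - unfold count; rewrite (filter_ext _ (fun _ => true) prefb_nil), filter_true, length_words.
    simpl; lra.
  - destruct s as [|s].
    + unfold count; simpl; pose proof (pow_half_pos (length u)); lra.
    + rewrite count_S.
      assert (E : forall c, count (fun w => prefb (b :: u) (c :: w)) s =
                if Bool.eqb b c then count (prefb u) s else 0%nat).
      { intros c; rewrite (count_ext _ (fun w => Bool.eqb b c && prefb u w)%bool)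
          by (intros; apply prefb_cons).
        destruct (Bool.eqb b c); [apply count_ext; reflexivity|apply count_false]. }
      rewrite !E; specialize (IH s).
      replace (2 ^ S s * (/ 2) ^ length (b :: u)) with (2 ^ s * (/ 2) ^ length u)
        by (simpl; field).
      destruct b; simpl Bool.eqb; rewrite plus_INR; simpl INR; lra.
Qed.

(** The path goes left whenever the left child still has extensions of every length. Otherwise the
    right child has them. *)
Lemma koenig (U : list bool -> Prop) :
  (forall w v, U (w ++ v) -> U w) -> (forall s, exists w, length w = s /\ U w) ->
  exists x, forall s, U (prefix x s).
Proof.
  intros HU Hinf.
  set (ext := fun w => forall s, exists v, length v = s /\ U (w ++ v)).
  assert (Hext : forall w, ext w -> ~ ext (w ++ [false]) -> ext (w ++ [true])).
  { intros w Hw Hf s.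
    apply not_all_ex_not in Hf as [s0 Hs0].
    (* The left child has no extension by [s0] letters. An extension long enough for both [s] and
       [s0] must therefore go right. *)
    destruct (Hw (S (s + s0))) as [[|b v] [Hl Hv]]; [discriminate|]; injection Hl as Hl.
    destruct b.
    - exists (firstn s v); split; [rewrite length_firstn; lia|].
      apply HU with (skipn s v); rewrite <- !app_assoc, firstn_skipn; exact Hv.
    - exfalso; apply Hs0; exists (firstn s0 v); split; [rewrite length_firstn; lia|].
      apply HU with (skipn s0 v); rewrite <- !app_assoc, firstn_skipn; exact Hv. }
  set (bit := fun w => if excluded_middle_informative (ext (w ++ [false])) then false else true).
  set (pw := fix pw n := match n with O => [] | S n => pw n ++ [bit (pw n)] end).
  set (x := fun n => bit (pw n)).
  assert (Hpw : forall n, prefix x n = pw n).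
  { induction n as [|n IH]; [reflexivity|]; rewrite prefix_S, IH; reflexivity. }
  assert (Hall : forall n, ext (pw n)).
  { induction n as [|n IH]; [exact Hinf|]; simpl pw; unfold bit.
    destruct (excluded_middle_informative _) as [H|H]; [exact H|exact (Hext _ IH H)]. }
  exists x; intros s; rewrite Hpw; destruct (Hall s 0%nat) as [v [_ Hv]].
  exact (HU _ _ Hv).
Qed.

(** Compactness. A word of length n is tested against the first n cylinders of a cover, which makes
    the uncovered words of [T] a tree [U]. An infinite path through [U] would be an uncovered path
    of [T], so some level s of [U] is empty. There each word of [T] lies below one of s cylinders,
    whose weights bound the count. *)
Lemma null_tree_small (T : list bool -> bool) eps :
  (forall w v, T (w ++ v) = true -> T w = true) ->
  null_C (paths (fun w => T w = true)) -> 0 < eps ->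
  exists s, INR (count T s) <= eps * 2 ^ s.
Proof.
  intros HT Hnull He; destruct (Hnull eps He) as [ws [Hcov Hsum]].
  set (U := fun w => T w = true /\ forall i, (i < length w)%nat -> prefb (ws i) w = false).
  assert (HU : forall w v, U (w ++ v) -> U w).
  { intros w v [H1 H2]; split; [exact (HT w v H1)|]; intros i Hi.
    apply Bool.not_true_iff_false; intros E.
    specialize (H2 i); rewrite length_app in H2.
    apply prefb_spec in E as [El E].
    apply Bool.eq_true_false_abs with (prefb (ws i) (w ++ v)); [|apply H2; lia].
    apply prefb_spec; rewrite length_app; split; [lia|].
    intros j Hj; rewrite app_nth1 by lia; apply E, Hj. }
  destruct (classic (forall s, exists w, length w = s /\ U w)) as [Hinf|Hfin].
  - exfalso; destruct (koenig U HU Hinf) as [x Hx].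
    destruct (Hcov x) as [i Hi]; [intros n; apply (Hx n)|].
    (* This length exceeds the index [i], so that cylinder [i] is tested, and is at least the length
       of [ws i], so that the test succeeds. *)
    destruct (Hx (S i + length (ws i))%nat) as [_ H]; specialize (H i).
    rewrite prefix_length in H; rewrite (proj2 (prefb_prefix (ws i) x (S i + length (ws i))%nat ltac:(lia)) Hi) in H.
    discriminate H; lia.
  - apply not_all_ex_not in Hfin as [s Hs]; exists s.
    apply Rle_trans with (lsum (fun i => INR (count (prefb (ws i)) s)) (seq 0 s)).
    + assert (Hc : forall w, length w = s -> T w = true ->
                exists i, In i (seq 0 s) /\ prefb (ws i) w = true).
      { intros w Hl Hw; apply NNPP; intros Hno; apply Hs; exists w; split; [exact Hl|].
        split; [exact Hw|]; intros i Hi; apply Bool.not_true_iff_false; intros E.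
        apply Hno; exists i; split; [apply in_seq; lia|exact E]. }
      (* A union bound, generalised from the full level to any list of words of length [s] for the
         induction. *)
      enough (E : forall l, (forall w, In w l -> length w = s) ->
        INR (length (filter T l)) <=
        lsum (fun i => INR (length (filter (prefb (ws i)) l))) (seq 0 s))
        by (apply E; intros w; apply in_words).
      induction l as [|w l IH]; intros Hl.
      * apply (lsum_nonneg (fun i => INR _)); intros; apply pos_INR.
      * specialize (IH (fun v Hv => Hl v (or_intror Hv))).
        apply Rle_trans with
          (lsum (fun i => (if prefb (ws i) w then 1 else 0) +
                          INR (length (filter (prefb (ws i)) l))) (seq 0 s)).
        -- rewrite lsum_plus; simpl filter; destruct (T w) eqn:Ew.
           ++ simpl length; rewrite S_INR.
              destruct (Hc w (Hl w (or_introl eq_refl)) Ew) as [i [Hi Ei]].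
              enough (1 <= lsum (fun i => if prefb (ws i) w then 1 else 0) (seq 0 s)) by lra.
              apply Rle_trans with (lsum (fun i => if prefb (ws i) w then 1 else 0) [i]).
              ** unfold lsum; simpl; rewrite Ei; lra.
              ** apply lsum_incl; [intros j; cbn beta; destruct (prefb (ws j) w); lra| |].
                 --- repeat constructor; intros [].
                 --- intros j [<-|[]]; exact Hi.
           ++ enough (0 <= lsum (fun i => if prefb (ws i) w then 1 else 0) (seq 0 s)) by lra.
              apply lsum_nonneg; intros j; cbn beta; destruct (prefb (ws j) w); lra.
        -- apply lsum_le; intros i _; simpl filter.
           destruct (prefb (ws i) w); [simpl length; rewrite S_INR|]; lra.
    + eapply Rle_trans; [apply lsum_le; intros i _; apply count_prefb|].
      rewrite lsum_scal, Rmult_comm; apply Rmult_le_compat_r; [|apply Hsum].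
      apply pow_le; lra.
Qed.

(** * Finding a section of positive measure *)

Open Scope nat_scope.

(** Only containment in a single enumerated basic set is recognised. For points this is enough: a
    point is removed exactly when one of its prefixes is. *)
Definition excl (p : nat -> nat) (s m : nat) (w : list bool) : bool :=
  existsb (fun t => negb (p t =? 0) && ((fst (unpair (pred (p t))) =? m) &&
                    prefb (wordof (snd (unpair (pred (p t))))) w))%bool (seq 0 s).

Lemma trk_excl {A} `{Enc A} (l : A -> list nat) (s m : A -> nat) (w : A -> list bool) :
  Trk l -> Trk s -> Trk m -> Trk w ->
  Trk (fun a => excl (fun i => nth i (l a) 0) (s a) (m a) (w a)).
Proof.
  intros Hl Hs Hm Hw.
  apply (trk_reindex (fun l (e : nat * (nat * list bool)) =>
           excl (fun i => nth i l 0) (fst e) (fst (snd e)) (snd (snd e)))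
           l (fun a => (s a, (m a, w a)))); [unfold excl|..]; trk.
Qed.

Hint Resolve trk_excl : trk.

Lemma excl_spec p s m w :
  excl p s m w = true <->
  exists t k, t < s /\ p t = S k /\ fst (unpair k) = m /\ prefb (wordof (snd (unpair k))) w = true.
Proof.
  unfold excl; rewrite existsb_exists; split.
  - intros [t [Ht%in_seq E]]; rewrite !Bool.andb_true_iff, Nat.eqb_eq in E.
    destruct E as [E0 [Em Ew]], (p t) as [|k] eqn:Ep; [discriminate|].
    exists t, k; repeat split; auto; lia.
  - intros [t [k [Ht [Ep [Em Ew]]]]]; exists t; rewrite Ep; split; [apply in_seq; lia|].
    rewrite !Bool.andb_true_iff, Nat.eqb_eq; auto.
Qed.

Lemma prefb_app u w v : prefb u w = true -> prefb u (w ++ v) = true.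
Proof.
  rewrite !prefb_spec, length_app; intros [Hl H]; split; [lia|].
  intros i Hi; rewrite app_nth1 by lia; apply H, Hi.
Qed.

Lemma excl_mono p s s' m w v : s <= s' -> excl p s m w = true -> excl p s' m (w ++ v) = true.
Proof.
  rewrite !excl_spec; intros Hs [t [k [Ht [Ep [Em Ew]]]]].
  exists t, k; repeat split; auto using prefb_app; lia.
Qed.

Lemma existsb_ext {T} (f g : T -> bool) l :
  (forall x, In x l -> f x = g x) -> existsb f l = existsb g l.
Proof.
  induction l as [|x l IH]; intros E; [reflexivity|]; simpl.
  rewrite E, IH; auto using in_eq, in_cons.
Qed.

Lemma forallb_ext {T} (f g : T -> bool) l :
  (forall x, In x l -> f x = g x) -> forallb f l = forallb g l.
Proof.
  induction l as [|x l IH]; intros E; [reflexivity|]; simpl.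
  rewrite E, IH; auto using in_eq, in_cons.
Qed.

Lemma excl_ext p p' s m w : (forall i, i < s -> p i = p' i) -> excl p s m w = excl p' s m w.
Proof. intros E; apply existsb_ext; intros t Ht%in_seq; rewrite E by lia; reflexivity. Qed.

Lemma rep_ANC_excl p A m x :
  rep ANC p A -> A (m, x) <-> forall s, excl p s m (prefix x s) = false.
Proof.
  intros Hp; rewrite (Hp (m, x)); split.
  - intros Hno s; apply Bool.not_true_iff_false; intros [t [k [_ [E [Em Ew]]]]]%excl_spec.
    apply Hno; exists t, k; split; [exact E|].
    rewrite <- (pair_unpair k); apply basic_NC_pair; split; [auto|].
    exact (prefb_prefix_in_cyl _ _ _ Ew).
  - intros Hs [t [k [E Hb]]].
    rewrite <- (pair_unpair k) in Hb; apply basic_NC_pair in Hb as [Em Hb]; cbn in Em, Hb.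
    specialize (Hs (S t + length (wordof (snd (unpair k))))).
    apply Bool.not_true_iff_false in Hs; apply Hs, excl_spec; exists t, k.
    repeat split; auto; [lia|]; apply prefb_prefix; [lia|exact Hb].
Qed.

(** Testing a word of length n against the first n items makes membership decidable and closed under
    prefixes, while the paths are still exactly the points of section [m]. *)
Definition sect (p : nat -> nat) (m : nat) (w : list bool) : bool := negb (excl p (length w) m w).

Lemma sect_tree p m w v : sect p m (w ++ v) = true -> sect p m w = true.
Proof.
  unfold sect; rewrite !Bool.negb_true_iff, <- !Bool.not_true_iff_false.
  intros H E; apply H, excl_mono with (length w); [rewrite length_app; lia|exact E].
Qed.

Lemma sect_ext p p' m w :
  (forall i, i < length w -> p i = p' i) -> sect p m w = sect p' m w.
Proof. intros E; unfold sect; f_equal; apply excl_ext, E. Qed.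

Lemma paths_sect p A m x :
  rep ANC p A -> A (m, x) <-> paths (fun w => sect p m w = true) x.
Proof.
  intros Hp; rewrite (rep_ANC_excl p A m x Hp); unfold paths, sect.
  split; intros H n; specialize (H n); rewrite prefix_length in *; destruct (excl _ _ _ _); auto.
Qed.

Open Scope R_scope.

(** Section m gets the share eps/2 * 2^-(m+1) and is covered by the words surviving on one
    sufficiently thin level. The other half of eps pays for the padding in [flatten_cover]. *)
Lemma null_NC_sections p A :
  rep ANC p A ->
  (forall m eta, 0 < eta -> exists s, INR (count (sect p m) s) <= eta * 2 ^ s) -> null_NC A.
Proof.
  intros Hp Hsec eps He.
  assert (Hs : forall m, exists s, INR (count (sect p m) s) <= eps / 2 * (/ 2) ^ S m * 2 ^ s).
  { intros m; apply Hsec, Rmult_lt_0_compat; [lra|apply pow_half_pos]. }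
  apply IndefiniteDescription.functional_choice in Hs as [lv Hlv].
  set (wt := fun c : nat * list bool => (/ 2) ^ length (snd c)).
  set (L := fun m => map (fun w => (m, w)) (filter (sect p m) (words (lv m)))).
  destruct (flatten_cover wt L (eps / 2) (eps / 2)) as [cs [Hin Hsum]].
  - intros c; left; apply pow_half_pos.
  - intros d Hd; destruct (pow_half_small d Hd) as [n Hn]; exists (0%nat, repeat false n).
    unfold wt; cbn [snd]; rewrite repeat_length; lra.
  - lra.
  - intros n; eapply Rle_trans; [|apply (lsum_geom (eps / 2) n); lra].
    apply lsum_le; intros m _; unfold L; rewrite lsum_map.
    rewrite (lsum_ext _ (fun _ => (/ 2) ^ lv m)).
    + rewrite lsum_const; fold (count (sect p m) (lv m)); specialize (Hlv m).
      apply Rmult_le_reg_r with (2 ^ lv m); [apply pow_lt; lra|].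
      rewrite Rmult_assoc, <- Rpow_mult_distr, Rinv_l, pow1 by lra; lra.
    + intros w [Hw _]%filter_In; apply in_words in Hw; unfold wt; cbn [snd]; rewrite Hw; reflexivity.
  - exists cs; split; [|intros N; replace eps with (eps / 2 + eps / 2) by lra; apply Hsum].
    intros [m x] Hx.
    destruct (Hin m (m, prefix x (lv m))) as [k Hk].
    { unfold L; apply in_map_iff; exists (prefix x (lv m)); split; [reflexivity|].
      apply filter_In; split; [apply in_words, prefix_length|].
      apply (paths_sect p A m x Hp), Hx. }
    exists k; rewrite Hk; cbn [fst snd]; split; [reflexivity|].
    unfold in_cyl; rewrite prefix_length; reflexivity.
Qed.

Open Scope nat_scope.

(** Here [g] codes a pair (m, k), and the test says that level s of section m has density at least
    2^-k, with denominators cleared. One failing s refutes the guess. *)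
Definition large (p : nat -> nat) (g s : nat) : bool :=
  2 ^ s <=? count (sect p (fst (unpair g))) s * 2 ^ snd (unpair g).

(** The least candidate not refuted by stage [i]. The value 0 is a dummy for stages at which no
    candidate is left among those considered. *)
Definition guess (p : nat -> nat) (i : nat) : nat :=
  hd 0 (filter (fun g => forallb (large p g) (seq 0 (S i))) (seq 0 (S i))).

(** The tree [T] below the word 0^m 1. The clause on the length admits the proper prefixes of that
    word; for them [skipn] returns the empty word, so the root of [T] must be present. *)
Definition shifted (m : nat) (T : list bool -> bool) (w : list bool) : bool :=
  forallb (fun i => (length w <=? i) || Bool.eqb (nth i w false) (i =? m))%bool (seq 0 (S m)) &&
  T (skipn (S m) w).

Lemma shifted_spec m T w :
  shifted m T w = true <->
  (forall i, i <= m -> i < length w -> nth i w false = (i =? m)) /\ T (skipn (S m) w) = true.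
Proof.
  unfold shifted; rewrite Bool.andb_true_iff, forallb_forall.
  split; intros [H1 H2]; (split; [|exact H2]); intros i Hi.
  - intros Hl; assert (Hin : In i (seq 0 (S m))) by (apply in_seq; lia).
    specialize (H1 i Hin); apply Bool.orb_true_iff in H1 as [H1|H1].
    + apply Nat.leb_le in H1; lia.
    + apply Bool.eqb_prop, H1.
  - apply in_seq in Hi; apply Bool.orb_true_iff; rewrite Nat.leb_le, Bool.eqb_true_iff.
    destruct (Nat.le_gt_cases (length w) i); [auto|right; apply H1; lia].
Qed.

Lemma shifted_O_true T w : shifted 0 T (true :: w) = T w.
Proof.
  apply Bool.eq_true_iff_eq; rewrite shifted_spec; simpl skipn; split; [intros [_ H]; exact H|].
  intros H; split; [|exact H]; intros i Hi; replace i with 0 by lia; reflexivity.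
Qed.

Lemma shifted_S_false m T w : shifted (S m) T (false :: w) = shifted m T w.
Proof.
  apply Bool.eq_true_iff_eq; rewrite !shifted_spec; split; intros [H1 H2]; (split; [|exact H2]).
  - intros i Hi Hl; apply (H1 (S i)); simpl; lia.
  - intros [|i] Hi Hl; [reflexivity|]; apply H1; simpl in Hl; lia.
Qed.

(** Each of the m + 1 letters of 0^m 1 halves the density, whence the factor 2^(m+1). At level 0 the
    root is counted, which uses [T []]. *)
Lemma count_shifted m T k : T [] = true ->
  (forall s, 2 ^ s <= count T s * 2 ^ k) ->
  forall s, 2 ^ s <= count (shifted m T) s * (2 ^ S m * 2 ^ k).
Proof.
  intros HT H.
  assert (H0 : forall m, 2 ^ 0 <= count (shifted m T) 0 * (2 ^ S m * 2 ^ k)).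
  { intros n; replace (count (shifted n T) 0) with 1.
    - pose proof (Nat.pow_nonzero 2 (S n)); pose proof (Nat.pow_nonzero 2 k).
      change (2 ^ 0) with 1; nia.
    - unfold count; change (words 0) with [@nil bool]; cbn [filter]; replace (shifted n T []) with true; [reflexivity|].
      symmetry; apply shifted_spec; rewrite skipn_nil; split; [simpl; lia|exact HT]. }
  induction m as [|m IH]; intros [|s]; [apply H0| |apply H0|]; rewrite count_S.
  - rewrite (count_ext (fun w => shifted 0 T (true :: w)) T) by apply shifted_O_true.
    specialize (H s); rewrite (Nat.pow_succ_r' 2 s); change (2 ^ 1) with 2; nia.
  - rewrite (count_ext (fun w => shifted (S m) T (false :: w)) (shifted m T))
      by apply shifted_S_false.
    specialize (IH s); rewrite (Nat.pow_succ_r' 2 s), (Nat.pow_succ_r' 2 (S m)); nia.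
Qed.

Lemma skipn_prefix {A} (x : nat -> A) k n :
  skipn k (prefix x n) = prefix (fun i => x (k + i)) (n - k).
Proof.
  destruct (Nat.le_gt_cases k n) as [Hk|Hk].
  - apply (nth_ext _ _ (x 0) (x 0)); [rewrite length_skipn, !prefix_length; reflexivity|].
    intros i Hi; rewrite length_skipn, prefix_length in Hi.
    rewrite nth_skipn, !nth_prefix by lia; reflexivity.
  - replace (n - k) with 0 by lia; apply skipn_all2; rewrite prefix_length; lia.
Qed.

Lemma paths_shifted m T x :
  paths (fun w => shifted m T w = true) x <->
  (forall i, i <= m -> x i = (i =? m)) /\
  paths (fun w => T w = true) (fun i => x (S m + i)).
Proof.
  unfold paths; split.
  - intros H; split.
    + intros i Hi; destruct (proj1 (shifted_spec _ _ _) (H (S m))) as [H1 _].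
      rewrite <- H1, nth_prefix; rewrite ?prefix_length; auto; lia.
    + intros n; destruct (proj1 (shifted_spec _ _ _) (H (S m + n))) as [_ H2].
      rewrite skipn_prefix in H2; replace (S m + n - S m) with n in H2 by lia; exact H2.
  - intros [H1 H2] n; apply shifted_spec; split.
    + intros i Hi Hl; rewrite prefix_length in Hl; rewrite nth_prefix by exact Hl; auto.
    + rewrite skipn_prefix; apply H2.
Qed.

Lemma shifted_tree m T w v :
  (forall w v, T (w ++ v) = true -> T w = true) ->
  shifted m T (w ++ v) = true -> shifted m T w = true.
Proof.
  intros HT; rewrite !shifted_spec, length_app, skipn_app; intros [H1 H2]; split; [|eauto].
  intros i Hi Hl; rewrite <- H1, app_nth1; auto; lia.
Qed.

Lemma not_null_shifted m T k : T [] = true ->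
  (forall w v, T (w ++ v) = true -> T w = true) ->
  (forall s, 2 ^ s <= count T s * 2 ^ k) ->
  ~ null_C (paths (fun w => shifted m T w = true)).
Proof.
  intros Hnil HT Hc Hnull.
  (* The densities stay above 2^-(m+1+k), so half of that value is a small enough bound for a
     contradiction. *)
  destruct (null_tree_small (shifted m T) ((/ 2) ^ (S (S m + k))))%R as [s Hs].
  - intros w v; apply shifted_tree, HT.
  - exact Hnull.
  - apply pow_half_pos.
  - pose proof (count_shifted m T k Hnil Hc s) as H; apply le_INR in H.
    rewrite !mult_INR, !pow_INR in H; change (INR 2) with 2%R in H.
    assert (E : ((/ 2) ^ S (S m + k) * (2 ^ S m * 2 ^ k) = / 2)%R).
    { rewrite <- pow_add; change ((/ 2) ^ S (S m + k))%R with (/ 2 * (/ 2) ^ (S m + k))%R.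
      rewrite Rmult_assoc, <- Rpow_mult_distr, Rinv_l, pow1 by lra; lra. }
    assert (P : (0 < 2 ^ s)%R) by (apply pow_lt; lra).
    assert (Q : (0 < 2 ^ S m * 2 ^ k)%R) by (apply Rmult_lt_0_compat; apply pow_lt; lra).
    apply Rmult_le_compat_r with (r := (2 ^ S m * 2 ^ k)%R) in Hs; [|lra].
    replace ((/ 2) ^ S (S m + k) * 2 ^ s * (2 ^ S m * 2 ^ k))%R
      with ((/ 2) ^ S (S m + k) * (2 ^ S m * 2 ^ k) * 2 ^ s)%R in Hs by ring.
    rewrite E in Hs; lra.
Qed.

(** The empty set is null: the padding of [flatten_cover] alone has arbitrarily small total
    weight. *)
Lemma not_null_C_inhabited A : ~ null_C A -> exists x, A x.
Proof.
  intros HA; apply NNPP; intros Hno; apply HA; intros eps He.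
  destruct (flatten_cover (fun w : list bool => (/ 2) ^ length w)%R (fun _ => []) 0 eps)%R as [ws [_ Hs]].
  - intros c; left; apply pow_half_pos.
  - intros d Hd; destruct (pow_half_small d Hd) as [k Hk]; exists (repeat false k).
    rewrite repeat_length; lra.
  - exact He.
  - intros k; rewrite lsum_const; unfold lsum; simpl; lra.
  - exists ws; split; [|intros M; specialize (Hs M); lra].
    intros x Hx; exfalso; eauto.
Qed.

Lemma hd_filter_seq f d g n :
  g < n -> f g = true -> (forall g', g' < g -> f g' = false) ->
  hd d (filter f (seq 0 n)) = g.
Proof.
  intros Hg Hf Hlt; replace n with (g + S (n - g - 1)) by lia.
  rewrite seq_app, filter_app.
  replace (filter f (seq 0 g)) with (@nil nat); [simpl; rewrite Hf; reflexivity|].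
  symmetry; apply length_zero_iff_nil.
  destruct (filter f (seq 0 g)) as [|a l] eqn:E; [reflexivity|exfalso].
  assert (Ha : In a (filter f (seq 0 g))) by (rewrite E; left; reflexivity).
  apply filter_In in Ha as [Ha%in_seq Ea]; rewrite Hlt in Ea; [discriminate|lia].
Qed.

(** Take the least correct guess. Each of the finitely many smaller ones is refuted at some level;
    once the stage has passed all these levels and the guess itself, the search always returns
    it. *)
Lemma guess_stable p g :
  (forall s, large p g s = true) ->
  exists g0 N, (forall s, large p g0 s = true) /\ forall i, N <= i -> guess p i = g0.
Proof.
  induction g as [g IH] using (well_founded_induction lt_wf); intros Hg.
  destruct (classic (exists g', g' < g /\ forall s, large p g' s = true)) as [[g' [Hl Hg']]|Hno].
  { exact (IH g' Hl Hg'). }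
  assert (HN : forall b, b <= g -> exists N, forall g', g' < b ->
            exists s, s <= N /\ large p g' s = false).
  { induction b as [|b IHb]; intros Hb; [exists 0; lia|].
    destruct (IHb ltac:(lia)) as [N HN].
    destruct (classic (exists s, large p b s = false)) as [[s Hs]|Hs].
    - exists (N + s); intros g' Hg'; destruct (Nat.eq_dec g' b) as [->|Hne].
      + exists s; split; [lia|exact Hs].
      + destruct (HN g' ltac:(lia)) as [s' [Hs' E]]; exists s'; split; [lia|exact E].
    - exfalso; apply Hno; exists b; split; [lia|]; intros s.
      apply Bool.not_false_iff_true; intros E; apply Hs; exists s; exact E. }
  destruct (HN g (le_n g)) as [N HN']; exists g, (N + g); split; [exact Hg|].
  intros i Hi; apply hd_filter_seq; [lia|apply forallb_forall; auto|].
  intros g' Hg'; destruct (HN' g' Hg') as [s [Hs E]].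
  apply Bool.not_true_iff_false; rewrite forallb_forall; intros Hall.
  rewrite Hall in E; [discriminate|apply in_seq; lia].
Qed.

Lemma trk_guess {A} `{Enc A} (l : A -> list nat) (i : A -> nat) :
  Trk l -> Trk i -> Trk (fun a => guess (fun j => nth j (l a) 0) (i a)).
Proof.
  intros Hl Hi.
  apply (trk_reindex (fun l i => guess (fun j => nth j l 0) i)); [|exact Hl|exact Hi].
  unfold guess, large, count, sect; trk.
Qed.

Lemma trk_shifted {A} `{Enc A} (m : A -> nat) (T : A -> list bool -> bool) (w : A -> list bool) :
  Trk m -> Trk (fun e : A * list bool => T (fst e) (snd e)) -> Trk w ->
  Trk (fun a => shifted (m a) (T a) (w a)).
Proof.
  intros Hm HT Hw; unfold shifted; apply trk_andb.
  - apply (trk_reindex (fun m w => forallb (fun i => (length w <=? i) ||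
       Bool.eqb (nth i w false) (i =? m))%bool (seq 0 (S m)))); trk.
  - apply (trk_reindex T); trk.
Qed.

Hint Resolve trk_guess trk_shifted : trk.

Lemma guess_ext p p' i : (forall j, j <= i -> p j = p' j) -> guess p i = guess p' i.
Proof.
  intros E; unfold guess; f_equal; apply filter_ext_in; intros g _.
  apply forallb_ext; intros s Hs%in_seq; unfold large, count; do 3 f_equal.
  apply filter_ext_in; intros w Hw%in_words; apply sect_ext; intros j Hj; apply E; lia.
Qed.

(** At stage [i] the current guess for a pair [(m, k)] with mu(A_m) >= 2^-k is used to put
    the [i]-th version of section [m] below the word 0^m 1, from which [m] can be read off. *)
Lemma PC_NC_le_WWKL : sW_le PC_NC (djump WWKL).
Proof.
  set (V := fun u (p : Baire) =>
    if shifted (fst (unpair (guess p (fst (unpair u)))))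
         (fun w => sect p (fst (unpair (guess p (fst (unpair u))))) w) (wordof (snd (unpair u)))
    then 1 else 0).
  (* The first nonzero letter occurs at an unbounded position, so this map has no fixed modulus and
     is undefined on the zero sequence. Positive even positions are free in the product
     representation and are set to 0. *)
  set (H := fun (q r : Baire) => exists m, (forall i, i < m -> q i = 0) /\ q m <> 0 /\
       forall k, r k = if k =? 0 then m else if Nat.even k then 0 else q (S m + Nat.div2 k)).
  set (first := fun l => hd 0 (filter (fun i => negb (nth i l 0 =? 0)) (seq 0 (length l)))).
  apply (sW_le_intro _ _ H (pointwise V)).
  - apply (computable_intro (fun k l =>
      if existsb (fun i => negb (nth i l 0 =? 0)) (seq 0 (length l)) then
        if k =? 0 then S (first l) else if Nat.even k then 1 else
          if S (S (first l + Nat.div2 k)) <=? length l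
          then S (nth (S (first l) + Nat.div2 k) l 0) else 0
      else 0)); [unfold first; trk|].
    intros q r [m [Hz [Hm Hr]]] k.
    assert (Hex : forall n, existsb (fun i => negb (nth i (prefix q n) 0 =? 0))
                    (seq 0 (length (prefix q n))) = (S m <=? n)).
    { intros n; apply Bool.eq_true_iff_eq; rewrite existsb_exists, Nat.leb_le, prefix_length; split.
      - intros [i [Hi%in_seq E]]; destruct (Nat.le_gt_cases (S m) n); [assumption|].
        rewrite nth_prefix, Hz in E by lia; discriminate.
      - intros Hn; exists m; split; [apply in_seq; lia|].
        rewrite nth_prefix by lia; apply Bool.negb_true_iff, Nat.eqb_neq, Hm. }
    assert (Hf : forall n, S m <= n -> first (prefix q n) = m).
    { intros n Hn; unfold first; rewrite prefix_length; apply hd_filter_seq; [lia| |].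
      - rewrite nth_prefix by lia; apply Bool.negb_true_iff, Nat.eqb_neq, Hm.
      - intros i Hi; rewrite nth_prefix, Hz by lia; reflexivity. }
    rewrite (Hr k); cbn beta; generalize (Nat.div2 k); intros d; split.
    + exists (S (S (m + d))); rewrite Hex, (Hf (S (S (m + d)))) by lia.
      rewrite (proj2 (Nat.leb_le (S m) (S (S (m + d))))) by lia.
      rewrite prefix_length, Nat.leb_refl.
      destruct (k =? 0); [reflexivity|]; destruct (Nat.even k); [reflexivity|].
      rewrite nth_prefix by lia; reflexivity.
    + intros n; rewrite Hex; destruct (Nat.leb_spec (S m) n) as [Hn|Hn]; [|auto].
      rewrite Hf, prefix_length by exact Hn.
      destruct (k =? 0); [auto|]; destruct (Nat.even k); [auto|].
      destruct (Nat.leb_spec (S (S (m + d))) n); [|auto].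
      rewrite nth_prefix by lia; auto.
  (* Position u = <i,j> needs only the inputs up to u, because u bounds both the stage i and the
     length of word number j. *)
  - apply (computable_pointwise S); [trk|unfold V, sect; trk|].
    intros u p p' E; unfold V.
    pose proof (pair_ge (fst (unpair u)) (snd (unpair u))) as Hu; rewrite pair_unpair in Hu.
    rewrite (guess_ext p p') by (intros; apply E; lia).
    unfold shifted; rewrite (sect_ext p p'); [reflexivity|].
    intros i Hi; apply E; rewrite length_skipn in Hi.
    pose proof (length_le_codeword (wordof (snd (unpair u)))) as Hl.
    rewrite codeword_wordof in Hl; lia.
  - intros p A Hp [mx [HnA _]].
    (* If every pair (m, k) were refuted, each section tree would thin out below every 2^-k, and [A]
       would be null. *)
    assert (Hg : exists g, forall s, large p g s = true).
    { apply NNPP; intros Hno; apply HnA, (null_NC_sections p A Hp).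
      intros m eta Heta; destruct (pow_half_small eta Heta) as [k Hk].
      destruct (not_all_ex_not _ _ (not_ex_all_not _ _ Hno (Defs.pair m k))) as [s Hs].
      exists s; revert Hs; unfold large; rewrite unpair_pair; cbn [fst snd].
      intros Hs; apply Bool.not_true_iff_false, Nat.leb_gt, lt_INR in Hs.
      rewrite mult_INR, !pow_INR in Hs; change (INR 2) with 2%R in Hs.
      assert (P : (0 < 2 ^ k)%R) by (apply pow_lt; lra).
      assert (Q : (0 < 2 ^ s)%R) by (apply pow_lt; lra).
      apply Rle_trans with ((/ 2) ^ k * 2 ^ s)%R; [|apply Rmult_le_compat_r; lra].
      apply Rmult_le_reg_r with (2 ^ k)%R; [exact P|].
      replace ((/ 2) ^ k * 2 ^ s * 2 ^ k)%R with ((/ 2 * 2) ^ k * 2 ^ s)%R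
        by (rewrite Rpow_mult_distr; ring).
      rewrite Rinv_l, pow1 by lra; lra. }
    destruct Hg as [g0 Hg0]; destruct (guess_stable p g0 Hg0) as [g [N [Hg Hst]]].
    set (m := fst (unpair g)).
    set (T := shifted m (sect p m)).
    assert (HnT : ~ null_C (paths (fun w => T w = true))).
    { apply not_null_shifted with (snd (unpair g)).
      - reflexivity.
      - apply sect_tree.
      - intros s; apply Nat.leb_le, Hg. }
    exists (fun u => V u p), (fun w => T w = true).
    split; [intros k; reflexivity|]; split; [|split].
    + exists (fun j => if T (wordof j) then 1 else 0); split.
      * assert (Hcol : forall i, N <= i -> forall j, column (fun u => V u p) i j =
                          if T (wordof j) then 1 else 0).
        { intros i Hi j; unfold column, V; rewrite unpair_pair; cbn [fst snd].
          rewrite Hst by exact Hi; reflexivity. }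
        exists N; split; [intros i Hi j|intros j]; rewrite !Hcol; auto.
      * split; [intros w v; apply shifted_tree, sect_tree|]; split.
        -- intros j; destruct (T (wordof j)); auto.
        -- intros w; rewrite wordof_codeword; destruct (T w); split; auto; discriminate.
    + destruct (not_null_C_inhabited _ HnT) as [x Hx]; exists x; split; [exact HnT|exact Hx].
    + intros q x Hq [_ Hx]; apply paths_shifted in Hx as [Hx1 Hx2].
      exists (fun k => if k =? 0 then m else if Nat.even k then 0 else q (S m + Nat.div2 k)),
        (m, fun i => x (S m + i)); split; [|split; [|split]].
      * exists m; split; [|split; [|reflexivity]].
        -- intros i Hi; rewrite (Hq i), Hx1, (proj2 (Nat.eqb_neq _ _)) by lia; reflexivity.
        -- rewrite (Hq m), Hx1, Nat.eqb_refl by lia; discriminate.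
      * split; [reflexivity|]; intros n.
        rewrite Nat.even_succ, Nat.odd_mul, Nat.div2_succ_double; apply Hq.
      * exact HnA.
      * apply (paths_sect p A m _ Hp), Hx2.
Qed.

(** * Binary expansions of reals *)

Open Scope R_scope.

Definition qnum (k : nat) : Z := zigzag (fst (unpair k)).
Definition qden (k : nat) : nat := S (snd (unpair k)).
Definition qcode (z : Z) (d : nat) : nat := Defs.pair (zagzig z) (pred d).

Lemma qval_eq k : qval k = IZR (qnum k) / INR (qden k).
Proof. unfold qval, qnum, qden; destruct (unpair k); reflexivity. Qed.

Lemma qval_qcode z d : (0 < d)%nat -> qval (qcode z d) = IZR z / INR d.
Proof.
  intros Hd; rewrite qval_eq; unfold qnum, qden, qcode; rewrite unpair_pair; cbn [fst snd].
  rewrite zigzag_zagzig; replace (S (pred d)) with d by lia; reflexivity.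
Qed.

Definition rle (z1 : Z) (d1 : nat) (z2 : Z) (d2 : nat) : bool :=
  (z1 * Z.of_nat d2 <=? z2 * Z.of_nat d1)%Z.

Lemma rle_spec z1 d1 z2 d2 : (0 < d1)%nat -> (0 < d2)%nat ->
  rle z1 d1 z2 d2 = true <-> IZR z1 / INR d1 <= IZR z2 / INR d2.
Proof.
  intros H1%lt_0_INR H2%lt_0_INR; unfold rle; rewrite Z.leb_le.
  assert (E : (z1 * Z.of_nat d2 <= z2 * Z.of_nat d1)%Z <->
              IZR z1 * INR d2 <= IZR z2 * INR d1).
  { rewrite !INR_IZR_INZ, <- !mult_IZR; split; [apply IZR_le|apply le_IZR]. }
  rewrite E; clear E.
  replace (IZR z1 * INR d2) with (IZR z1 / INR d1 * (INR d1 * INR d2)) by (field; lra).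
  replace (IZR z2 * INR d1) with (IZR z2 / INR d2 * (INR d1 * INR d2)) by (field; lra).
  assert (P : 0 < INR d1 * INR d2) by (apply Rmult_lt_0_compat; assumption).
  split; intros H; [apply Rmult_le_reg_r in H; assumption|apply Rmult_le_compat_r; lra].
Qed.

Lemma rle_false z1 d1 z2 d2 : (0 < d1)%nat -> (0 < d2)%nat ->
  rle z1 d1 z2 d2 = false <-> IZR z2 / INR d2 < IZR z1 / INR d1.
Proof.
  intros H1 H2; rewrite <- Bool.not_true_iff_false, rle_spec by assumption; lra.
Qed.

Lemma trk_qnum {A} `{Enc A} (f : A -> nat) : Trk f -> Trk (fun a => qnum (f a)).
Proof. intros Hf; unfold qnum; trk. Qed.

Lemma trk_qden {A} `{Enc A} (f : A -> nat) : Trk f -> Trk (fun a => qden (f a)).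
Proof. intros Hf; unfold qden; trk. Qed.

Lemma trk_qcode {A} `{Enc A} (z : A -> Z) (d : A -> nat) :
  Trk z -> Trk d -> Trk (fun a => qcode (z a) (d a)).
Proof. intros Hz Hd; unfold qcode; trk. Qed.

Lemma trk_rle {A} `{Enc A} (z1 : A -> Z) (d1 : A -> nat) (z2 : A -> Z) (d2 : A -> nat) :
  Trk z1 -> Trk d1 -> Trk z2 -> Trk d2 -> Trk (fun a => rle (z1 a) (d1 a) (z2 a) (d2 a)).
Proof. intros; unfold rle; trk. Qed.

Hint Resolve trk_qnum trk_qden trk_qcode trk_rle : trk.

Lemma qden_pos k : (0 < qden k)%nat.
Proof. unfold qden; lia. Qed.

Lemma pow_pos_nat b n : (0 < b)%nat -> (0 < b ^ n)%nat.
Proof. intros Hb; pose proof (Nat.pow_nonzero b n); lia. Qed.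

Lemma basic_R_pair a b x : basic_R (Defs.pair a b) x <-> qval a < x < qval b.
Proof. unfold basic_R; rewrite unpair_pair; reflexivity. Qed.

Lemma half_pow n : (/ 2) ^ n = / INR (2 ^ n).
Proof. rewrite pow_INR, pow_inv; reflexivity. Qed.

(** The integer with binary digits [x 0, ..., x (n-1)] (most significant first)
    following the binary expansion of [m]. *)
Definition bw (m : nat) (x : nat -> bool) (n : nat) : nat :=
  natrec m (fun i v => 2 * v + bitn (x i))%nat n.
Notation bv := (bw 0).

Lemma bw_S m x n : bw m x (S n) = (2 * bw m x n + bitn (x n))%nat.
Proof. reflexivity. Qed.

Lemma bw_ext m x y n : (forall i, (i < n)%nat -> x i = y i) -> bw m x n = bw m y n.
Proof.
  induction n as [|n IH]; intros E; [reflexivity|].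
  rewrite !bw_S, IH, E; auto.
Qed.

Lemma trk_bw {A} `{Enc A} (m : A -> nat) (x : A -> nat -> bool) (n : A -> nat) :
  Trk m -> Trk (fun e : A * nat => x (fst e) (snd e)) -> Trk n ->
  Trk (fun a => bw (m a) (x a) (n a)).
Proof.
  intros Hm Hx Hn; unfold bw; apply trk_natrec; [trk| |trk].
  apply trk_add; [trk|]; unfold bitn; apply trk_if; [apply (trk_reindex x)|..]; trk.
Qed.

Hint Resolve trk_bw : trk.

Lemma nested_point (lo hi : nat -> R) :
  (forall n, lo n <= lo (S n)) -> (forall n, hi (S n) <= hi n) -> (forall n, lo n <= hi n) ->
  exists t, forall n, lo n <= t <= hi n.
Proof.
  intros Hlo Hhi Hlh.
  assert (Mlo : forall n k, lo n <= lo (n + k)%nat).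
  { intros n k; induction k as [|k IH]; [rewrite Nat.add_0_r; lra|].
    rewrite Nat.add_succ_r; specialize (Hlo (n + k)%nat); lra. }
  assert (Mhi : forall n k, hi (n + k)%nat <= hi n).
  { intros n k; induction k as [|k IH]; [rewrite Nat.add_0_r; lra|].
    rewrite Nat.add_succ_r; specialize (Hhi (n + k)%nat); lra. }
  assert (Hub : forall m n, lo m <= hi n).
  { intros m n; specialize (Mlo m n); specialize (Mhi n m); specialize (Hlh (m + n)%nat).
    rewrite (Nat.add_comm n m) in Mhi; lra. }
  destruct (completeness (fun r => exists n, r = lo n)) as [t [Ht1 Ht2]].
  - exists (hi 0%nat); intros r [n ->]; apply Hub.
  - exists (lo 0%nat), 0%nat; reflexivity.
  - exists t; intros n; split; [apply Ht1; exists n; reflexivity|].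
    apply Ht2; intros r [m ->]; apply Hub.
Qed.

Lemma Rdiv_le_scale a b c d : 0 < b -> 0 < c -> a * c <= d -> a / b <= d / (b * c).
Proof.
  intros Hb Hc H; apply Rmult_le_reg_r with (b * c); [apply Rmult_lt_0_compat; assumption|].
  replace (a / b * (b * c)) with (a * c) by (field; lra).
  replace (d / (b * c) * (b * c)) with d by (field; lra); exact H.
Qed.

Lemma Rdiv_ge_scale a b c d : 0 < b -> 0 < c -> d <= a * c -> d / (b * c) <= a / b.
Proof.
  intros Hb Hc H; apply Rmult_le_reg_r with (b * c); [apply Rmult_lt_0_compat; assumption|].
  replace (a / b * (b * c)) with (a * c) by (field; lra).
  replace (d / (b * c) * (b * c)) with d by (field; lra); exact H.
Qed.

Lemma bitn_bound b : 0 <= INR (bitn b) <= 1.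
Proof. destruct b; simpl; lra. Qed.

Lemma bval_exists x : exists t, forall n,
  INR (bv x n) / INR (2 ^ n) <= t <= (INR (bv x n) + 1) / INR (2 ^ n).
Proof.
  assert (P : forall n, 0 < INR (2 ^ n)) by (intros; apply lt_0_INR, pow_pos_nat; lia).
  apply nested_point; intros n; specialize (P n).
  - rewrite Nat.pow_succ_r', Nat.mul_comm, mult_INR; apply Rdiv_le_scale; [exact P|simpl; lra|].
    rewrite bw_S, plus_INR, mult_INR; pose proof (bitn_bound (x n)); simpl (INR 2); lra.
  - rewrite Nat.pow_succ_r', Nat.mul_comm, mult_INR; apply Rdiv_ge_scale; [exact P|simpl; lra|].
    rewrite bw_S, plus_INR, mult_INR; pose proof (bitn_bound (x n)); simpl (INR 2); lra.
  - apply Rmult_le_compat_r; [left; apply Rinv_0_lt_compat, P|lra].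
Qed.

(** The real number sum_i x_i 2^-(i+1), given as the common point of its dyadic intervals. *)
Definition bval (x : nat -> bool) : R :=
  proj1_sig (constructive_indefinite_description _ (bval_exists x)).

Lemma bval_spec x n : INR (bv x n) / INR (2 ^ n) <= bval x <= (INR (bv x n) + 1) / INR (2 ^ n).
Proof. exact (proj2_sig (constructive_indefinite_description _ (bval_exists x)) n). Qed.

Lemma Rabs_small_eq a b c : (forall n, Rabs (a - b) <= c * (/ 2) ^ n) -> a = b.
Proof.
  intros H; destruct (Req_dec a b) as [|Hne]; [assumption|exfalso].
  assert (P : 0 < Rabs (a - b)) by (apply Rabs_pos_lt; lra).
  assert (Hc : 0 < c) by (specialize (H 0%nat); simpl in H; lra).
  destruct (pow_half_small (Rabs (a - b) / c)) as [n Hn]; [apply Rdiv_lt_0_compat; lra|].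
  specialize (H n); apply Rmult_lt_compat_l with (r := c) in Hn; [|exact Hc].
  replace (c * (Rabs (a - b) / c)) with (Rabs (a - b)) in Hn by (field; lra); lra.
Qed.

(** Greedy digits: [rem n] is the error after n digits scaled by 2^n, and it stays in [0, 1]. For t
    = 1 all digits are 1. *)
Lemma bval_surj t : 0 <= t <= 1 -> exists x, bval x = t.
Proof.
  intros Ht.
  set (digit := fun r => if Rle_dec 1 (2 * r) then true else false).
  set (rem := fix rem n := match n with O => t | S n => 2 * rem n - INR (bitn (digit (rem n))) end).
  exists (fun n => digit (rem n)).
  assert (Hrem : forall n, 0 <= rem n <= 1).
  { induction n as [|n IH]; [exact Ht|]; simpl rem; unfold digit.
    destruct (Rle_dec 1 (2 * rem n)); simpl; lra. }
  assert (Hbv : forall n, INR (bv (fun n => digit (rem n)) n) = t * INR (2 ^ n) - rem n).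
  { induction n as [|n IH]; [simpl; lra|].
    rewrite bw_S, plus_INR, mult_INR, IH, Nat.pow_succ_r', mult_INR; simpl; lra. }
  apply Rabs_small_eq with 1; intros n; rewrite Rmult_1_l, half_pow.
  assert (P : 0 < INR (2 ^ n)) by (apply lt_0_INR, pow_pos_nat; lia).
  pose proof (bval_spec (fun n => digit (rem n)) n) as [B1 B2]; rewrite Hbv in B1, B2.
  specialize (Hrem n); set (b := bval _) in *.
  assert (Q : 0 < / INR (2 ^ n)) by (apply Rinv_0_lt_compat, P).
  replace ((t * INR (2 ^ n) - rem n) / INR (2 ^ n)) with (t - rem n * / INR (2 ^ n)) in B1
    by (field; lra).
  replace ((t * INR (2 ^ n) - rem n + 1) / INR (2 ^ n))
    with (t + (1 - rem n) * / INR (2 ^ n)) in B2 by (field; lra).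
  apply Rabs_le; nra.
Qed.

(** The closed set is pulled back along (m, x) |-> [zigzag m] + [bval x]. A cylinder is removed once
    its closed dyadic image interval lies strictly inside an enumerated rational interval. Reals
    with two expansions do no harm, because digits are never extracted from a real. *)
Lemma PC_R_le_PC_NC : sW_le PC_R PC_NC.
Proof.
  set (low := fun m x n => (zigzag m * Z.of_nat (2 ^ n) + Z.of_nat (bv x n))%Z).
  set (inside := fun k m w =>
    (negb (rle (low m (fun i => nth i w false) (length w)) (2 ^ length w)
               (qnum (fst (unpair k))) (qden (fst (unpair k)))) &&
     negb (rle (qnum (snd (unpair k))) (qden (snd (unpair k)))
               (low m (fun i => nth i w false) (length w) + 1) (2 ^ length w)))%bool).
  set (V := fun u (p : Baire) =>
    if (negb (p (fst (unpair u)) =? 0)%nat &&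
        inside (pred (p (fst (unpair u)))) (fst (unpair (snd (unpair u))))
               (wordof (snd (unpair (snd (unpair u))))))%bool
    then S (snd (unpair u)) else 0%nat).
  (* The left end of the k-th dyadic interval is an approximation with error at most 2^-k. *)
  set (W := fun k (q : Baire) =>
    qcode (low (q 0%nat) (fun i => negb (q (S (2 * i)) =? 0)%nat) k) (2 ^ k)).
  assert (P2 : forall n, (0 < 2 ^ n)%nat) by (intros; apply pow_pos_nat; lia).
  assert (P2R : forall n, 0 < INR (2 ^ n)) by (intros; apply lt_0_INR, P2).
  assert (Hlow : forall m x n, IZR (low m x n) / INR (2 ^ n) =
                   IZR (zigzag m) + INR (bv x n) / INR (2 ^ n)).
  { intros m x n; unfold low; rewrite plus_IZR, mult_IZR, <- !INR_IZR_INZ.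
    specialize (P2R n); field; lra. }
  assert (Hlow1 : forall m x n, IZR (low m x n + 1) / INR (2 ^ n) =
                   IZR (zigzag m) + (INR (bv x n) + 1) / INR (2 ^ n)).
  { intros m x n; unfold low; rewrite !plus_IZR, mult_IZR, <- !INR_IZR_INZ.
    specialize (P2R n); field; lra. }
  assert (Hin : forall k m w, inside k m w = true <->
     qval (fst (unpair k)) <
       IZR (zigzag m) + INR (bv (fun i => nth i w false) (length w)) / INR (2 ^ length w) /\
     IZR (zigzag m) + (INR (bv (fun i => nth i w false) (length w)) + 1) / INR (2 ^ length w)
       < qval (snd (unpair k))).
  { intros k m w; unfold inside; rewrite Bool.andb_true_iff, !Bool.negb_true_iff.
    rewrite !rle_false by auto using qden_pos; rewrite Hlow, Hlow1, <- !qval_eq; reflexivity. }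
  apply (sW_le_intro _ _ (pointwise W) (pointwise V)).
  - apply (computable_pointwise (fun k => S (S (2 * k)))); [trk|unfold W, low; trk|].
    intros k q q' E; unfold W, low; rewrite (E 0%nat) by lia.
    rewrite (bw_ext 0 _ (fun i => negb (q' (S (2 * i)) =? 0)%nat)); [reflexivity|].
    intros i Hi; rewrite E by lia; reflexivity.
  - assert (Rin : Trk (fun e : nat * (nat * list bool) =>
                    inside (fst e) (fst (snd e)) (snd (snd e)))) by (unfold inside, low; trk).
    apply (computable_pointwise S); [trk| |].
    { unfold V; apply trk_if; [apply trk_andb; [trk|]|trk|trk].
      apply (trk_reindex (fun k (e : nat * list bool) => inside k (fst e) (snd e)) _
               (fun e : nat * list nat => (fst (unpair (snd (unpair (fst e)))),
                  wordof (snd (unpair (snd (unpair (fst e)))))))); [exact Rin|trk|trk]. }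
    intros u p p' E; unfold V.
    pose proof (pair_ge (fst (unpair u)) (snd (unpair u))) as Hu; rewrite pair_unpair in Hu.
    rewrite E by lia; reflexivity.
  - intros p A Hp [y0 [HnA Hy0]].
    set (A' := fun mx : nat * (nat -> bool) => A (IZR (zigzag (fst mx)) + bval (snd mx))).
    assert (Honto : forall y, exists m x, y = IZR (zigzag m) + bval x).
    { intros y; destruct (archimed y) as [U1 U2].
      destruct (bval_surj (y - (IZR (up y) - 1))) as [x Hx]; [lra|].
      exists (zagzig (up y - 1)), x; rewrite zigzag_zagzig, minus_IZR, Hx; lra. }
    assert (HnA' : ~ null_NC A').
    { intros Hnull; apply HnA; intros eps He.
      destruct (Hnull (eps / 2)) as [cs [Hcov Hsum]]; [lra|].
      set (c := fun i => IZR (zigzag (fst (cs i))) +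
        INR (bv (fun j => nth j (snd (cs i)) false) (length (snd (cs i)))) /
          INR (2 ^ length (snd (cs i)))).
      set (l := fun i => (/ 2) ^ length (snd (cs i))).
      (* The closed interval [c, c + l] is fattened to an open one of length 2 l, which is why the
         cover of [A'] was taken for eps/2. *)
      exists (fun i => (c i - l i / 2, c i + 3 / 2 * l i)); split.
      - intros y Hy; destruct (Honto y) as [m [x ->]].
        destruct (Hcov (m, x) Hy) as [i [Em Ex]]; exists i; cbn [fst snd] in *.
        pose proof (bval_spec x (length (snd (cs i)))) as Hb.
        rewrite (bw_ext 0 x (fun j => nth j (snd (cs i)) false)) in Hb
          by (apply in_cyl_spec, Ex).
        pose proof (pow_half_pos (length (snd (cs i)))) as Hl.
        unfold c, l; rewrite Rdiv_plus_distr in Hb; rewrite half_pow in *; subst m.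
        unfold Rdiv in *; lra.
      - intros N; eapply Rle_trans; [|apply Rle_trans with (2 * (eps / 2)); [|lra]].
        2:{ apply Rmult_le_compat_l; [lra|apply (Hsum N)]. }
        change (lsum (fun i => Rmax 0 (snd (c i - l i / 2, c i + 3 / 2 * l i) -
                  fst (c i - l i / 2, c i + 3 / 2 * l i))) (seq 0 N) <=
                2 * lsum l (seq 0 N)).
        rewrite <- lsum_scal; apply lsum_le; intros i _; cbn [fst snd].
        assert (0 < l i) by apply pow_half_pos.
        rewrite Rmax_right; lra. }
    exists (fun u => V u p), A'; split; [intros k; reflexivity|]; split; [|split].
    + intros [m x]; unfold A'; cbn [fst snd]; rewrite (Hp _); split.
      * intros Hno [u [k [E Hb]]]; unfold V in E.
        destruct (Nat.eqb_spec (p (fst (unpair u))) 0) as [|E0]; [discriminate|].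
        destruct (inside _ _ _) eqn:Ein; [|discriminate]; injection E as <-.
        apply Hin in Ein; rewrite <- (pair_unpair (snd (unpair u))) in Hb.
        apply basic_NC_pair in Hb as [Em Hb]; cbn [fst snd] in Em, Hb.
        set (w := wordof _) in *.
        pose proof (bval_spec x (length w)) as Hx.
        rewrite (bw_ext 0 x (fun j => nth j w false)) in Hx by (apply in_cyl_spec, Hb).
        apply Hno; exists (fst (unpair u)), (pred (p (fst (unpair u)))); split; [lia|].
        rewrite <- (pair_unpair (pred _)); apply basic_R_pair; subst m; lra.
      * intros Hno [n [k [E Hb]]]; rewrite <- (pair_unpair k) in Hb.
        apply basic_R_pair in Hb as [Ha Hb]; set (y := IZR (zigzag m) + bval x) in *.
        (* At level [L] the dyadic interval around y is shorter than the distance from y to either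
           end point, hence strictly inside. *)
        destruct (pow_half_small (Rmin (y - qval (fst (unpair k))) (qval (snd (unpair k)) - y)))
          as [L HL]; [apply Rmin_glb_lt; lra|].
        pose proof (Rmin_l (y - qval (fst (unpair k))) (qval (snd (unpair k)) - y)).
        pose proof (Rmin_r (y - qval (fst (unpair k))) (qval (snd (unpair k)) - y)).
        apply Hno; exists (Defs.pair n (Defs.pair m (codeword (prefix x L)))),
          (Defs.pair m (codeword (prefix x L))); split.
        -- unfold V; rewrite !unpair_pair; cbn [fst snd]; rewrite !unpair_pair; cbn [fst snd].
           rewrite E, wordof_codeword; cbn [Nat.eqb negb andb pred].
           rewrite (proj2 (Hin _ _ _)); [reflexivity|].
           rewrite prefix_length, (bw_ext 0 _ x) by (intros; apply nth_prefix; assumption).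
           pose proof (bval_spec x L) as Hx.
           rewrite Rdiv_plus_distr in *; rewrite half_pow in HL; unfold y, Rdiv in *; lra.
        -- apply basic_NC_pair; split; [reflexivity|]; cbn [snd].
           rewrite wordof_codeword; unfold in_cyl; rewrite prefix_length; reflexivity.
    + destruct (Honto y0) as [m [x ->]]; exists (m, x); split; [exact HnA'|exact Hy0].
    + intros q [m x] [Hm Hq] [_ Hx]; cbn [fst snd] in *.
      exists (fun k => W k q), (IZR (zigzag m) + bval x); split; [intros k; reflexivity|].
      split; [|split; [exact HnA|exact Hx]].
      intros n; unfold W; rewrite qval_qcode, Hlow, Hm by apply P2.
      rewrite (bw_ext 0 _ x) by (intros i _; rewrite Hq; destruct (x i); reflexivity).
      pose proof (bval_spec x n) as Hb; rewrite Rdiv_plus_distr in Hb; rewrite half_pow.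
      unfold Rdiv in *; apply Rabs_le; lra.
Qed.

(** * A Cantor set of positive measure *)

Open Scope nat_scope.

(** [fl m x n / 4^n] is the left end of the level-[n] interval around
    [psi m x = 4 m + sum_i x_i (2^-(i+1) + 3 * 4^-(i+1))]; the interval has length
    [2^-n + 4^-n], so neighbouring ones are at distance at least [2 * 4^-n]. *)
Definition fl (m : nat) (x : nat -> bool) (n : nat) : nat :=
  natrec (4 * m) (fun i v => 4 * v + bitn (x i) * (2 ^ S i + 3)) n.

Lemma fl_S m x n : fl m x (S n) = 4 * fl m x n + bitn (x n) * (2 ^ S n + 3).
Proof. reflexivity. Qed.

Lemma fl_ext m x y n : (forall i, i < n -> x i = y i) -> fl m x n = fl m y n.
Proof.
  induction n as [|n IH]; intros E; [reflexivity|].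
  rewrite !fl_S, IH, E; auto.
Qed.

Lemma trk_fl {A} `{Enc A} (m : A -> nat) (x : A -> nat -> bool) (n : A -> nat) :
  Trk m -> Trk (fun e : A * nat => x (fst e) (snd e)) -> Trk n ->
  Trk (fun a => fl (m a) (x a) (n a)).
Proof.
  intros Hm Hx Hn; unfold fl; apply trk_natrec; [trk| |trk].
  apply trk_add; [trk|]; apply trk_mul; [|trk].
  unfold bitn; apply trk_if; [apply (trk_reindex x)|..]; trk.
Qed.

Hint Resolve trk_fl : trk.

Lemma fl_ge m x n : 4 * m * 4 ^ n <= fl m x n.
Proof.
  induction n as [|n IH]; [unfold fl; cbn [natrec Nat.pow]; lia|].
  rewrite fl_S, Nat.pow_succ_r'; nia.
Qed.

(** The inverse of [bw] at level n: the last n binary digits are the word and the rest is the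
    section number. So the level-n cylinders of N x 2^N are numbered consecutively, in the order of
    their images. *)
Fixpoint cell (n v : nat) : nat * list bool :=
  match n with
  | 0 => (v, [])
  | S n => (fst (cell n (Nat.div2 v)), snd (cell n (Nat.div2 v)) ++ [Nat.odd v])
  end.

Lemma cell_bw m x n : cell n (bw m x n) = (m, prefix x n).
Proof.
  induction n as [|n IH]; [reflexivity|].
  rewrite prefix_S; simpl cell; rewrite bw_S.
  replace (Nat.div2 (2 * bw m x n + bitn (x n))) with (bw m x n).
  - rewrite IH; cbn [fst snd]; do 3 f_equal.
    rewrite Nat.odd_add, Nat.odd_mul; destruct (x n); reflexivity.
  - destruct (x n); unfold bitn.
    + rewrite Nat.add_1_r, Nat.div2_succ_double; reflexivity.
    + rewrite Nat.add_0_r, Nat.div2_double; reflexivity.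
Qed.

Lemma cell_length n v : length (snd (cell n v)) = n.
Proof.
  revert v; induction n as [|n IH]; intros v; [reflexivity|].
  simpl; rewrite length_app, IH; simpl; lia.
Qed.

(** [fl] equals 2^n * [bw] + 3 * [gw], where [gw] reads the same digits to base 4; this also
    explains the start value 4 m = m + 3 m. A larger [bw] forces a larger [gw]: if the parents
    differ, base 4 outweighs the last digit, and otherwise the last digit decides. The surplus 3
    comes from that one extra unit of [gw]. *)
Lemma fl_mono m x m' y n : bw m x n < bw m' y n ->
  fl m x n + 2 ^ n * bw m' y n + 3 <= fl m' y n + 2 ^ n * bw m x n.
Proof.
  set (gw := fun m x n => natrec m (fun i v => 4 * v + bitn (x i)) n).
  assert (Hfl : forall m x n, fl m x n = 2 ^ n * bw m x n + 3 * gw m x n).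
  { clear; intros m x n; induction n as [|n IH].
    { unfold fl, bw, gw; cbn [natrec Nat.pow]; lia. }
    change (gw m x (S n)) with (4 * gw m x n + bitn (x n)).
    rewrite fl_S, bw_S, IH, Nat.pow_succ_r'; ring. }
  assert (Heq : forall n, bw m x n = bw m' y n -> gw m x n = gw m' y n).
  { intros k E; pose proof (cell_bw m x k) as E1; rewrite E, cell_bw in E1.
    injection E1 as -> Ep; unfold gw.
    assert (Ex : forall i, i < k -> y i = x i).
    { intros i Hi; rewrite <- (nth_prefix x k i false Hi), <- Ep, nth_prefix; auto. }
    clear - Ex; induction k as [|k IH]; [reflexivity|]; cbn [natrec]; rewrite IH, Ex; auto. }
  assert (Hlt : forall n, bw m x n < bw m' y n -> gw m x n < gw m' y n).
  { clear n; induction n as [|n IH]; [exact (fun Hl => Hl)|].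
    change (gw m x (S n)) with (4 * gw m x n + bitn (x n)).
    change (gw m' y (S n)) with (4 * gw m' y n + bitn (y n)).
    rewrite !bw_S; intros Hl.
    assert (bitn (x n) <= 1) by (destruct (x n); simpl; lia).
    assert (bitn (y n) <= 1) by (destruct (y n); simpl; lia).
    destruct (Nat.lt_trichotomy (bw m x n) (bw m' y n)) as [L|[L|L]]; [|specialize (Heq n L)|]; lia. }
  intros Hl; specialize (Hlt n Hl); rewrite !Hfl; lia.
Qed.

Lemma fl_gap m x m' y n : (m, prefix x n) <> (m', prefix y n) ->
  fl m x n + 2 ^ n + 3 <= fl m' y n \/ fl m' y n + 2 ^ n + 3 <= fl m x n.
Proof.
  intros Hne.
  assert (Hb : bw m x n <> bw m' y n)
    by (intros E; apply Hne; rewrite <- !cell_bw, E; reflexivity).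
  destruct (Nat.lt_trichotomy (bw m x n) (bw m' y n)) as [L|[L|L]]; [left|contradiction|right];
    pose proof (fl_mono _ _ _ _ _ L) as E; nia.
Qed.

Open Scope R_scope.

Lemma pow4_pos n : 0 < INR (4 ^ n).
Proof. apply lt_0_INR, pow_pos_nat; lia. Qed.

Lemma psi_exists m x : exists t, forall n,
  INR (fl m x n) / INR (4 ^ n) <= t <= INR (fl m x n + 2 ^ n + 1) / INR (4 ^ n).
Proof.
  apply nested_point; intros n; pose proof (pow4_pos n) as P.
  - rewrite (Nat.pow_succ_r' 4), (Nat.mul_comm 4), (mult_INR (4 ^ n)); apply Rdiv_le_scale; [exact P|simpl; lra|].
    rewrite <- mult_INR; apply le_INR; rewrite fl_S; lia.
  - rewrite (Nat.pow_succ_r' 4), (Nat.mul_comm 4), (mult_INR (4 ^ n)); apply Rdiv_ge_scale; [exact P|simpl; lra|].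
    rewrite <- mult_INR; apply le_INR; rewrite fl_S, Nat.pow_succ_r'.
    assert (bitn (x n) <= 1)%nat by (destruct (x n); simpl; lia); nia.
  - apply Rmult_le_compat_r; [left; apply Rinv_0_lt_compat, P|apply le_INR; lia].
Qed.

Definition psi (m : nat) (x : nat -> bool) : R :=
  proj1_sig (constructive_indefinite_description _ (psi_exists m x)).

Definition holds_at (y : R) (m : nat) (x : nat -> bool) (n : nat) : Prop :=
  INR (fl m x n) / INR (4 ^ n) <= y <= INR (fl m x n + 2 ^ n + 1) / INR (4 ^ n).

Lemma psi_spec m x n : holds_at (psi m x) m x n.
Proof. exact (proj2_sig (constructive_indefinite_description _ (psi_exists m x)) n). Qed.

(** The level-n interval is widened by half of 4^-n at each end. As neighbours are at least 2 * 4^-n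
    apart, widened intervals stay disjoint, and an approximation with error 2^-(2n+1) = 4^-n / 2
    falls into the right one. *)
Definition near (r : R) (m : nat) (x : nat -> bool) (n : nat) : Prop :=
  INR (fl m x n) - / 2 <= r * INR (4 ^ n) <= INR (fl m x n + 2 ^ n + 1) + / 2.

Lemma near_unique r m x m' y n : near r m x n -> near r m' y n -> (m, prefix x n) = (m', prefix y n).
Proof.
  intros [H1 H2] [H3 H4]; apply NNPP; intros Hne.
  destruct (fl_gap m x m' y n Hne) as [H|H]; apply le_INR in H;
    rewrite !plus_INR in *; simpl (INR 1) in *; simpl (INR 3) in *; lra.
Qed.

Lemma holds_at_mul y m x n : holds_at y m x n <->
  INR (fl m x n) <= y * INR (4 ^ n) <= INR (fl m x n + 2 ^ n + 1).
Proof.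
  pose proof (pow4_pos n) as P; unfold holds_at.
  set (a := INR (fl m x n)); set (b := INR (_ + _)); set (c := INR (4 ^ n)) in *.
  assert (Ha : a = a / c * c) by (field; lra); assert (Hb : b = b / c * c) by (field; lra).
  split; intros [H1 H2].
  - rewrite Ha, Hb; split; apply Rmult_le_compat_r; lra.
  - rewrite Ha in H1; rewrite Hb in H2.
    split; [apply Rmult_le_reg_r in H1|apply Rmult_le_reg_r in H2]; auto.
Qed.

Lemma near_of_holds_at r y m x n :
  holds_at y m x n -> Rabs (r - y) <= (/ 2) ^ S (2 * n) -> near r m x n.
Proof.
  intros [H1 H2]%holds_at_mul Hr; pose proof (pow4_pos n) as P.
  assert (E : (/ 2) ^ S (2 * n) * INR (4 ^ n) = / 2).
  { rewrite pow_INR; change ((/ 2) ^ S (2 * n)) with (/ 2 * (/ 2) ^ (2 * n)).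
    rewrite pow_mult, Rmult_assoc, <- Rpow_mult_distr.
    replace ((/ 2) ^ 2 * INR 4) with 1 by (simpl; field); rewrite pow1; lra. }
  assert (Hb : - (/ 2) ^ S (2 * n) <= r - y <= (/ 2) ^ S (2 * n))
    by (unfold Rabs in Hr; destruct (Rcase_abs _); lra).
  destruct Hb as [Hr1 Hr2].
  apply (Rmult_le_compat_r (INR (4 ^ n))) in Hr1; [|lra].
  apply (Rmult_le_compat_r (INR (4 ^ n))) in Hr2; [|lra].
  unfold near; rewrite Ropp_mult_distr_l_reverse in Hr1; nra.
Qed.

Lemma near_of_holds y m x n : holds_at y m x n -> near y m x n.
Proof.
  intros H; apply (near_of_holds_at y y); [exact H|].
  rewrite Rminus_diag, Rabs_R0; left; apply pow_half_pos.
Qed.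

Lemma holds_at_le y m x n k : holds_at y m x (n + k) -> holds_at y m x n.
Proof.
  induction k as [|k IH]; [rewrite Nat.add_0_r; auto|].
  rewrite Nat.add_succ_r; set (l := (n + k)%nat) in *; intros H; apply IH; clear IH.
  apply holds_at_mul in H; apply holds_at_mul.
  rewrite Nat.pow_succ_r', mult_INR, fl_S, Nat.pow_succ_r' in H; simpl (INR 4) in H.
  assert (B : (bitn (x l) <= 1)%nat) by (destruct (x l); simpl; lia).
  assert (E1 : INR (4 * fl m x l) <= INR (4 * fl m x l + bitn (x l) * (2 * 2 ^ l + 3)))
    by (apply le_INR; lia).
  assert (E2 : INR (4 * fl m x l + bitn (x l) * (2 * 2 ^ l + 3) + 2 * 2 ^ l + 1) <=
               INR (4 * (fl m x l + 2 ^ l + 1))) by (apply le_INR; nia).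
  rewrite mult_INR in E1; rewrite (mult_INR 4 (_ + _ + _)) in E2; simpl (INR 4) in *; lra.
Qed.

(** This makes the code of a rational a computable bound for searches over section numbers. *)
Lemma qval_le_code k : qval k <= INR k.
Proof.
  rewrite qval_eq; pose proof (lt_0_INR _ (qden_pos k)) as P.
  assert (Hd : 1 <= INR (qden k)) by (change 1 with (INR 1); apply le_INR, qden_pos).
  assert (Hz : IZR (qnum k) <= INR k).
  { rewrite INR_IZR_INZ; apply IZR_le; unfold qnum, zigzag.
    pose proof (pair_ge (fst (unpair k)) (snd (unpair k))) as Hp; rewrite pair_unpair in Hp.
    pose proof (Nat.div2_decr (fst (unpair k)) k ltac:(lia)) as Hd2; revert Hd2.
    generalize (Nat.div2 (fst (unpair k))) (Nat.div2 (S (fst (unpair k)))).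
    destruct (Nat.even _); lia. }
  apply Rmult_le_reg_r with (INR (qden k)); [exact P|].
  replace (IZR (qnum k) / INR (qden k) * INR (qden k)) with (IZR (qnum k)) by (field; lra).
  pose proof (pos_INR k); nra.
Qed.

Lemma near_code k m x n : near (qval k) m x n -> (m <= k)%nat.
Proof.
  intros [H _]; pose proof (qval_le_code k) as Hk; pose proof (pow4_pos n) as P.
  pose proof (le_INR _ _ (fl_ge m x n)) as Hf; rewrite !mult_INR in Hf; simpl (INR 4) in Hf.
  assert (P1 : 1 <= INR (4 ^ n)) by (change 1 with (INR 1); apply le_INR, pow_pos_nat; lia).
  destruct m as [|m]; [lia|]; apply INR_le; rewrite S_INR in *; pose proof (pos_INR m).
  apply Rnot_lt_le; intros L.
  assert (qval k * INR (4 ^ n) < (INR m + 1) * INR (4 ^ n)) by (apply Rmult_lt_compat_r; lra).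
  assert (1 <= (INR m + 1) * INR (4 ^ n)) by nra.
  lra.
Qed.

Lemma qval_dense x y : x < y -> exists k, x < qval k < y.
Proof.
  intros Hxy; destruct (archimed_cor1 (y - x)) as [d [Hd Hd0]]; [lra|].
  exists (qcode (up (x * INR d)) d); rewrite qval_qcode by exact Hd0.
  assert (P : 0 < INR d) by (apply lt_0_INR, Hd0).
  destruct (archimed (x * INR d)) as [U1 U2]; set (z := IZR (up _)) in *.
  split; (apply Rmult_lt_reg_r with (INR d); [exact P|]);
    replace (z / INR d * INR d) with z by (field; lra); [lra|].
  apply (Rmult_lt_compat_r (INR d)) in Hd; [|exact P].
  rewrite Rinv_l in Hd by lra; lra.
Qed.

Lemma finite_gap {T} (lo hi : T -> R) (y : R) l :
  (forall c, In c l -> hi c < y \/ y < lo c) ->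
  exists d, 0 < d <= 1 /\ forall c, In c l -> hi c <= y - d \/ y + d <= lo c.
Proof.
  induction l as [|c l IH]; intros H; [exists 1; split; [lra|intros c []]|].
  destruct IH as [d [Hd Hl]]; [intros c' Hc'; apply H; right; exact Hc'|].
  assert (Hc : exists d', 0 < d' /\ (hi c <= y - d' \/ y + d' <= lo c)).
  { destruct (H c (or_introl eq_refl)) as [Hc|Hc];
      [exists (y - hi c)|exists (lo c - y)]; lra. }
  destruct Hc as [d' [Hd' Hc]]; exists (Rmin d d').
  pose proof (Rmin_l d d'); pose proof (Rmin_r d d'); split.
  - split; [apply Rmin_glb_lt; lra|lra].
  - intros c' [<-|Hc']; [|specialize (Hl c' Hc')]; lra.
Qed.

(** * Embedding into the reals *)

(** The witnesses for single levels fit together: intervals are nested along a point and disjoint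
    across cylinders, so the witness at s is a restriction of the one at any t >= s. The diagonal
    digits [snd (f (S i)) i] then define one point for all levels. *)
Lemma psi_of_approximations (P : nat -> nat -> list bool -> Prop) y :
  (forall s, exists m x, P s m (prefix x s) /\ holds_at y m x s) ->
  exists m x, y = psi m x /\ forall s, P s m (prefix x s).
Proof.
  intros H.
  assert (H' : forall s, exists mx : nat * (nat -> bool),
             P s (fst mx) (prefix (snd mx) s) /\ holds_at y (fst mx) (snd mx) s).
  { intros s; destruct (H s) as [m [x Hx]]; exists (m, x); exact Hx. }
  apply IndefiniteDescription.functional_choice in H' as [f Hf]; clear H.
  set (m := fst (f 0%nat)); set (x := fun i => snd (f (S i)) i).
  assert (Hco : forall s t, (s <= t)%nat ->
             (fst (f s), prefix (snd (f s)) s) = (fst (f t), prefix (snd (f t)) s)).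
  { intros s t Hst; apply near_unique with y; apply near_of_holds; [apply Hf|].
    apply holds_at_le with (t - s)%nat; replace (s + (t - s))%nat with t by lia; apply Hf. }
  assert (Hm : forall s, fst (f s) = m)
    by (intros s; injection (Hco 0%nat s ltac:(lia)) as E; symmetry; exact E).
  assert (Hx : forall s i, (i < s)%nat -> snd (f s) i = x i).
  { intros s i Hi; pose proof (f_equal snd (Hco (S i) s Hi)) as E; cbn [snd] in E; unfold x.
    rewrite <- (nth_prefix (snd (f s)) (S i) i false), <- E by lia; apply nth_prefix; lia. }
  exists m, x; split.
  (* The level-n interval has length 2^-n + 4^-n, at most 2 * 2^-n. *)
  - apply Rabs_small_eq with 2; intros n.
    destruct (Hf n) as [_ Hh]; rewrite Hm in Hh; unfold holds_at in Hh.
    rewrite (fl_ext m _ x n (Hx n)) in Hh.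
    destruct (psi_spec m x n) as [P1 P2], Hh as [H1 H2].
    assert (E : INR (fl m x n + 2 ^ n + 1) / INR (4 ^ n) <=
                INR (fl m x n) / INR (4 ^ n) + 2 * (/ 2) ^ n).
    { pose proof (pow4_pos n) as Q; apply Rmult_le_reg_r with (INR (4 ^ n)); [exact Q|].
      rewrite half_pow, Rmult_plus_distr_r.
      assert (Q2 : 1 <= INR (2 ^ n)) by (change 1 with (INR 1); apply le_INR, pow_pos_nat; lia).
      assert (E4 : INR (4 ^ n) = INR (2 ^ n) * INR (2 ^ n)).
      { rewrite <- mult_INR; f_equal; rewrite <- Nat.pow_mul_l; reflexivity. }
      replace (2 * / INR (2 ^ n) * INR (4 ^ n)) with (2 * INR (2 ^ n))
        by (rewrite E4; field; lra).
      unfold Rdiv; rewrite !Rmult_assoc, Rinv_l, !Rmult_1_r by lra.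
      rewrite !plus_INR; simpl (INR 1); lra. }
    apply Rabs_le; lra.
  - intros s; destruct (Hf s) as [Hp _]; rewrite Hm in Hp.
    rewrite <- (prefix_ext (snd (f s)) x s (Hx s)); exact Hp.
Qed.

(** If the cylinder numbers differ by 2 or more, the left ends are at least 2 * 2^k + 3 units of
    4^-k apart. Subtracting the length 2^k + 1 of the lower interval leaves more than 2^k units,
    that is 2^-k. *)
Lemma psi_close m x m' y k :
  psi m' y - psi m x < (/ 2) ^ k -> (bw m' y k <= bw m x k + 1)%nat.
Proof.
  intros Hd; apply Nat.nlt_ge; intros Hl.
  pose proof (fl_mono m x m' y k ltac:(lia)) as Hf.
  assert (Hf' : (fl m x k + 2 * 2 ^ k + 3 <= fl m' y k)%nat) by nia.
  destruct (proj1 (holds_at_mul _ _ _ _) (psi_spec m x k)) as [_ P1].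
  destruct (proj1 (holds_at_mul _ _ _ _) (psi_spec m' y k)) as [P2 _].
  pose proof (pow4_pos k) as Q; apply (Rmult_lt_compat_r (INR (4 ^ k))) in Hd; [|exact Q].
  assert (Q2 : 0 < INR (2 ^ k)) by (apply lt_0_INR, pow_pos_nat; lia).
  assert (E4 : INR (4 ^ k) = INR (2 ^ k) * INR (2 ^ k)).
  { rewrite <- mult_INR; f_equal; rewrite <- Nat.pow_mul_l; reflexivity. }
  assert (E : (/ 2) ^ k * INR (4 ^ k) = INR (2 ^ k)).
  { rewrite half_pow, E4; field; lra. }
  rewrite E in Hd; apply le_INR in Hf'.
  rewrite !plus_INR, mult_INR in *; simpl (INR 1) in *; simpl (INR 2) in *; simpl (INR 3) in *; lra.
Qed.

Lemma half_pow_bracket l : 0 < l <= 1 -> exists k, (/ 2) ^ S k < l <= (/ 2) ^ k.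
Proof.
  intros [H0 H1]; destruct (pow_half_small l H0) as [n Hn].
  induction n as [|n IH]; [simpl in Hn; lra|].
  destruct (Rle_lt_dec l ((/ 2) ^ n)) as [H|H]; [exists n; split; assumption|exact (IH H)].
Qed.

(** An interval of length at most [2^-k] meets [psi]-images of at most three neighbouring
    cylinders of measure [2^-k]. *)
Lemma cover_preimage a b l : 0 < l <= 1 -> b - a <= l ->
  exists L : list (nat * list bool),
    lsum (fun c => (/ 2) ^ length (snd c)) L <= 6 * l /\
    forall m x, a < psi m x < b -> exists k, In (m, prefix x k) L.
Proof.
  intros Hl Hab; destruct (half_pow_bracket l Hl) as [k [Hk1 Hk2]].
  destruct (classic (exists m x, a < psi m x < b)) as [[m0 [x0 H0]]|Hno].
  - set (v := bw m0 x0 k).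
    (* By the choice of k, 3 * 2^-k is below 6 l. For v = 0 the truncated v - 1 merely repeats v. *)
    exists (map (cell k) [v - 1; v; v + 1]%nat); split.
    + rewrite lsum_map; unfold lsum; cbn [map fold_right]; rewrite !cell_length.
      simpl in Hk1; lra.
    + intros m x Hx; exists k; rewrite <- cell_bw; apply in_map.
      pose proof (psi_close m x m0 x0 k ltac:(lra)) as C1.
      pose proof (psi_close m0 x0 m x k ltac:(lra)) as C2.
      simpl; fold v in C1, C2; lia.
  - exists []; split; [unfold lsum; simpl; lra|].
    intros m x Hx; exfalso; eauto.
Qed.

Lemma null_R_psi (A : nat * (nat -> bool) -> Prop) :
  null_R (fun y => exists m x, A (m, x) /\ y = psi m x) -> null_NC A.
Proof.
  intros Hnull eps He.
  (* Each length is enlarged by e * 2^-(i+1), because [cover_preimage] asks for positive lengths.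
     The total is then at most 2 e, and its factor 6 gives 12 e <= eps/2. The bound 1/4 keeps every
     length below 1. *)
  set (e := Rmin (eps / 24) (1 / 4)).
  assert (Hepos : 0 < e) by (apply Rmin_glb_lt; lra).
  assert (He1 : e <= eps / 24) by apply Rmin_l.
  assert (He2 : e <= 1 / 4) by apply Rmin_r.
  destruct (Hnull e Hepos) as [ab [Hcov Hsum]].
  set (l := fun i => Rmax 0 (snd (ab i) - fst (ab i)) + e * (/ 2) ^ S i).
  assert (Hl : forall n, lsum l (seq 0 n) <= 2 * e).
  { intros n; unfold l; rewrite lsum_plus.
    pose proof (lsum_geom e n ltac:(lra)); specialize (Hsum n).
    change (lsum (fun i => Rmax 0 (snd (ab i) - fst (ab i))) (seq 0 n) <= e) in Hsum; lra. }
  assert (Hl0 : forall i, 0 < l i).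
  { intros i; unfold l; pose proof (Rmax_l 0 (snd (ab i) - fst (ab i))).
    pose proof (Rmult_lt_0_compat _ _ Hepos (pow_half_pos (S i))); lra. }
  assert (Hli : forall i, l i <= 1).
  { intros i; apply Rle_trans with (lsum l (seq 0 (S i))); [|specialize (Hl (S i)); lra].
    rewrite lsum_seq_S.
    pose proof (lsum_nonneg l (seq 0 i) (fun j => Rlt_le _ _ (Hl0 j))); lra. }
  assert (HL : forall i, exists L : list (nat * list bool),
    lsum (fun c => (/ 2) ^ length (snd c)) L <= 6 * l i /\
    forall m x, fst (ab i) < psi m x < snd (ab i) -> exists k, In (m, prefix x k) L).
  { intros i; apply cover_preimage; [split; auto|]; unfold l.
    pose proof (Rmax_r 0 (snd (ab i) - fst (ab i))).
    pose proof (Rmult_lt_0_compat _ _ Hepos (pow_half_pos (S i))); lra. }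
  apply IndefiniteDescription.functional_choice in HL as [L HL].
  destruct (flatten_cover (fun c : nat * list bool => (/ 2) ^ length (snd c)) L (eps / 2) (eps / 2))
    as [cs [Hin Hcs]].
  - intros c; left; apply pow_half_pos.
  - intros d Hd; destruct (pow_half_small d Hd) as [n Hn]; exists (0%nat, repeat false n).
    cbn [snd]; rewrite repeat_length; lra.
  - lra.
  - intros n; apply Rle_trans with (lsum (fun i => 6 * l i) (seq 0 n)).
    + apply lsum_le; intros i _; apply HL.
    + rewrite lsum_scal; specialize (Hl n); lra.
  - exists cs; split; [|intros N; specialize (Hcs N); lra].
    intros [m x] HA; destruct (Hcov (psi m x)) as [i Hi]; [exists m, x; auto|].
    destruct (HL i) as [_ Hi']; destruct (Hi' m x Hi) as [k Hk].
    destruct (Hin i _ Hk) as [j Hj]; exists j; rewrite Hj; cbn [fst snd].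
    split; [reflexivity|]; unfold in_cyl; rewrite prefix_length; reflexivity.
Qed.

Definition nearb (c m : nat) (x : nat -> bool) (n : nat) : bool :=
  rle (Z.of_nat (2 * fl m x n) - Z.of_nat 1) (2 * 4 ^ n) (qnum c) (qden c) &&
  rle (qnum c) (qden c) (Z.of_nat (2 * (fl m x n + 2 ^ n + 1) + 1)) (2 * 4 ^ n).

Lemma nearb_spec c m x n : nearb c m x n = true <-> near (qval c) m x n.
Proof.
  assert (P : (0 < 2 * 4 ^ n)%nat) by (pose proof (pow_pos_nat 4 n); lia).
  unfold nearb; rewrite Bool.andb_true_iff, !rle_spec, <- qval_eq by auto using qden_pos.
  rewrite minus_IZR, <- !INR_IZR_INZ; unfold near.
  pose proof (pow4_pos n) as Q.
  rewrite (mult_INR 2 (4 ^ n)), (plus_INR (2 * _)), (mult_INR 2 (fl m x n)), (mult_INR 2 (_ + _ + _)).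
  simpl (INR 1); simpl (INR 2).
  set (a := INR (fl m x n)); set (b := INR (_ + _)); set (d := INR (4 ^ n)) in *.
  assert (E : forall u v, u / (2 * d) <= v <-> u <= v * (2 * d)).
  { intros u v; split; intros H.
    - apply (Rmult_le_compat_r (2 * d)) in H; [|lra].
      replace (u / (2 * d) * (2 * d)) with u in H by (field; lra); exact H.
    - apply Rmult_le_reg_r with (2 * d); [lra|].
      replace (u / (2 * d) * (2 * d)) with u by (field; lra); exact H. }
  assert (E' : forall u v, v <= u / (2 * d) <-> v * (2 * d) <= u).
  { intros u v; split; intros H.
    - apply (Rmult_le_compat_r (2 * d)) in H; [|lra].
      replace (u / (2 * d) * (2 * d)) with u in H by (field; lra); exact H.
    - apply Rmult_le_reg_r with (2 * d); [lra|].
      replace (u / (2 * d) * (2 * d)) with u by (field; lra); exact H. }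
  rewrite E, E'; split; intros [H1 H2]; split; lra.
Qed.

Lemma trk_nearb {A} `{Enc A} (c m : A -> nat) (x : A -> nat -> bool) (n : A -> nat) :
  Trk c -> Trk m -> Trk (fun e : A * nat => x (fst e) (snd e)) -> Trk n ->
  Trk (fun a => nearb (c a) (m a) (x a) (n a)).
Proof. intros; unfold nearb; trk. Qed.

Hint Resolve trk_nearb : trk.

(** The sections [m > b], where [b] is the code of the right end point, lie to the right of
    the interval, so that finitely many [m] have to be tested. *)
Definition misses (p : nat -> nat) (s k : nat) : bool :=
  forallb (fun m => forallb (fun w => excl p s m w ||
      (rle (qnum (snd (unpair k))) (qden (snd (unpair k)))
           (Z.of_nat (fl m (fun i => nth i w false) s)) (4 ^ s) ||
       rle (Z.of_nat (fl m (fun i => nth i w false) s + 2 ^ s + 1)) (4 ^ s)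
           (qnum (fst (unpair k))) (qden (fst (unpair k)))))%bool (words s))
    (seq 0 (S (snd (unpair k)))).

Lemma misses_spec p s k :
  misses p s k = true <-> forall m x, (m <= snd (unpair k))%nat ->
    excl p s m (prefix x s) = true \/
    qval (snd (unpair k)) <= INR (fl m x s) / INR (4 ^ s) \/
    INR (fl m x s + 2 ^ s + 1) / INR (4 ^ s) <= qval (fst (unpair k)).
Proof.
  assert (P : (0 < 4 ^ s)%nat) by (apply pow_pos_nat; lia).
  unfold misses; rewrite forallb_forall; split.
  - intros H m x Hm; assert (Hin : In m (seq 0 (S (snd (unpair k))))) by (apply in_seq; lia).
    specialize (H m Hin); rewrite forallb_forall in H.
    specialize (H (prefix x s) (proj2 (in_words _ _) (prefix_length _ _))).
    rewrite (fl_ext m _ x) in H by (intros; apply nth_prefix; assumption).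
    rewrite !Bool.orb_true_iff, !rle_spec, <- !qval_eq, <- !INR_IZR_INZ in H
      by auto using qden_pos; exact H.
  - intros H m Hm%in_seq; apply forallb_forall; intros w Hw%in_words.
    rewrite !Bool.orb_true_iff, !rle_spec, <- !qval_eq, <- !INR_IZR_INZ by auto using qden_pos.
    specialize (H m (fun i => nth i w false)); rewrite <- Hw in *; rewrite prefix_nth in H.
    apply H; lia.
Qed.

(** If no surviving interval of some level contains y, then y has positive distance from all of
    them, since only finitely many come near it. A rational interval around y within that distance
    then passes the test. *)
Lemma misses_complete p y :
  ~ (exists s k, misses p s k = true /\ basic_R k y) ->
  forall s, exists m x, excl p s m (prefix x s) = false /\ holds_at y m x s.
Proof.
  intros Hno s; apply NNPP; intros Hnx; apply Hno; clear Hno; exists s.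
  (* Sections m >= [M] start at 4 m >= M > y + 1, to the right of every interval used below, because
     [finite_gap] provides d <= 1. *)
  set (M := Z.to_nat (up (y + 1))).
  assert (HM : y + 1 < INR M).
  { destruct (archimed (y + 1)) as [U _]; unfold M; rewrite INR_IZR_INZ.
    apply Rlt_le_trans with (1 := U); apply IZR_le; lia. }
  set (lo := fun c : nat * list bool => INR (fl (fst c) (fun i => nth i (snd c) false) s) / INR (4 ^ s)).
  set (hi := fun c : nat * list bool =>
        INR (fl (fst c) (fun i => nth i (snd c) false) s + 2 ^ s + 1) / INR (4 ^ s)).
  destruct (finite_gap lo hi y (filter (fun c => negb (excl p s (fst c) (snd c)))
              (list_prod (seq 0 M) (words s)))) as [d [Hd Hgap]].
  { intros [m w] [Hin Hex]%filter_In; apply in_prod_iff in Hin as [_ Hw%in_words].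
    apply NNPP; intros Hb; apply Hnx; exists m, (fun i => nth i w false).
    split.
    - rewrite <- Hw at 2; rewrite prefix_nth; apply Bool.negb_true_iff, Hex.
    - split; apply Rnot_lt_le; intros H; apply Hb; [right|left]; exact H. }
  destruct (qval_dense (y - d) y) as [a Ha]; [lra|].
  destruct (qval_dense y (y + d)) as [b Hb]; [lra|].
  exists (Defs.pair a b); split; [|apply basic_R_pair; lra].
  apply misses_spec; rewrite unpair_pair; cbn [fst snd]; intros m x _.
  destruct (excl p s m (prefix x s)) eqn:Ex; [left; reflexivity|right].
  destruct (Nat.lt_ge_cases m M) as [Hm|Hm].
  - destruct (Hgap (m, prefix x s)) as [H|H].
    + apply filter_In; cbn [fst snd]; rewrite Ex; split; [|reflexivity].
      apply in_prod; [apply in_seq; lia|apply in_words, prefix_length].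
    + right; unfold hi in H; cbn [fst snd] in H.
      rewrite (fl_ext m _ x) in H by (intros; apply nth_prefix; assumption); lra.
    + left; unfold lo in H; cbn [fst snd] in H.
      rewrite (fl_ext m _ x) in H by (intros; apply nth_prefix; assumption); lra.
  - left; apply Rle_trans with (INR M); [lra|].
    apply Rle_trans with (INR m); [apply le_INR, Hm|].
    pose proof (pow4_pos s) as P; apply Rmult_le_reg_r with (INR (4 ^ s)); [exact P|].
    replace (INR (fl m x s) / INR (4 ^ s) * INR (4 ^ s)) with (INR (fl m x s)) by (field; lra).
    rewrite <- mult_INR; apply le_INR; pose proof (fl_ge m x s); nia.
Qed.

Lemma misses_sound p s k m x :
  misses p s k = true -> excl p s m (prefix x s) = false -> ~ basic_R k (psi m x).
Proof.
  intros Hmi Hex; rewrite <- (pair_unpair k); rewrite basic_R_pair; intros [Ha Hb].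
  destruct (psi_spec m x s) as [P1 P2].
  destruct (Nat.le_gt_cases m (snd (unpair k))) as [Hm|Hm].
  - destruct (proj1 (misses_spec p s k) Hmi m x Hm) as [H|[H|H]]; [congruence|lra|lra].
  - pose proof (qval_le_code (snd (unpair k))); apply lt_INR in Hm.
    destruct (psi_spec m x 0) as [P0 _]; unfold fl in P0; cbn [natrec] in P0.
    rewrite mult_INR in P0; simpl (INR 4) in P0; simpl (INR (4 ^ 0)) in P0.
    pose proof (pos_INR m); lra.
Qed.

Lemma trk_misses {A} `{Enc A} (l : A -> list nat) (s k : A -> nat) :
  Trk l -> Trk s -> Trk k -> Trk (fun a => misses (fun i => nth i (l a) 0%nat) (s a) (k a)).
Proof.
  intros Hl Hs Hk.
  apply (trk_reindex (fun l (e : nat * nat) => misses (fun i => nth i l 0%nat) (fst e) (snd e))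
           l (fun a => (s a, k a))); [unfold misses|..]; trk.
Qed.

Hint Resolve trk_misses : trk.

Lemma misses_ext p p' s k : (forall i, (i < s)%nat -> p i = p' i) -> misses p s k = misses p' s k.
Proof.
  intros E; apply forallb_ext; intros m _; apply forallb_ext; intros w _.
  rewrite (excl_ext p p') by exact E; reflexivity.
Qed.

(** The forward map names the image of [A] under [psi]: position <s,k> removes interval k if it
    misses everything that survives at stage s. A real that is never removed has a surviving cell at
    every level, and these cells glue to a point of [A]. *)
Lemma PC_NC_le_PC_R : sW_le PC_NC PC_R.
Proof.
  set (V := fun u (p : Baire) =>
    if misses p (fst (unpair u)) (snd (unpair u)) then S (snd (unpair u)) else 0%nat).
  set (base := fun c => hd 0%nat (filter (fun m => nearb c m (fun _ => false) 0) (seq 0 (S c)))).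
  set (digit := fun i c => existsb (fun m => existsb (fun w =>
      nearb c m (fun j => nth j w false) (S i) && nth i w false)%bool (words (S i))) (seq 0 (S c))).
  (* Entry 2n + 1 of the name has error at most 4^-n / 2, the tolerance of [near] at level n. Level
     0 already determines m, and digit i is read off at level i + 1. *)
  set (W := fun k (q : Baire) =>
    if (k =? 0)%nat then base (q 1%nat)
    else if digit (Nat.div2 k) (q (S (2 * S (Nat.div2 k)))) then 1%nat else 0%nat).
  apply (sW_le_intro _ _ (pointwise W) (pointwise V)).
  - apply (computable_pointwise (fun k => S (S (S (2 * S (Nat.div2 k))))));
      [trk|unfold W, base, digit; trk|].
    intros k q q' E; unfold W; generalize dependent (Nat.div2 k); intros d E.
    rewrite !E by lia; reflexivity.
  - apply (computable_pointwise S); [trk|unfold V; trk|].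
    intros u p p' E; unfold V.
    pose proof (pair_ge (fst (unpair u)) (snd (unpair u))) as Hu; rewrite pair_unpair in Hu.
    rewrite (misses_ext p p') by (intros; apply E; lia); reflexivity.
  - intros p A Hp [[m0 x0] [HnA HA0]].
    set (B := fun y => exists m x, A (m, x) /\ y = psi m x).
    assert (HnB : ~ null_R B) by (intros HB; exact (HnA (null_R_psi A HB))).
    exists (fun u => V u p), B; split; [intros k; reflexivity|]; split; [|split].
    + assert (HV : forall y, (exists n k, V n p = S k /\ basic_R k y) <->
                     exists s k, misses p s k = true /\ basic_R k y).
      { intros y; split.
        - intros [u [k [E Hb]]]; unfold V in E; destruct (misses _ _ _) eqn:Em; [|discriminate].
          injection E as <-; eauto.
        - intros [s [k [Em Hb]]]; exists (Defs.pair s k), k; split; [|exact Hb].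
          unfold V; rewrite unpair_pair; cbn [fst snd]; rewrite Em; reflexivity. }
      intros y; rewrite HV; split.
      * intros [m [x [HA ->]]] [s [k [Em Hb]]].
        exact (misses_sound p s k m x Em (proj1 (rep_ANC_excl p A m x Hp) HA s) Hb).
      * intros Hno; pose proof (misses_complete p y Hno) as Hap.
        destruct (psi_of_approximations (fun s m w => excl p s m w = false) y Hap)
          as [m [x [Ey Hx]]].
        exists m, x; split; [apply (rep_ANC_excl p A m x Hp), Hx|exact Ey].
    + exists (psi m0 x0); split; [exact HnB|exists m0, x0; auto].
    + intros q y Hq [_ [m [x [HA ->]]]].
      assert (Hnear : forall n, near (qval (q (S (2 * n)))) m x n)
        by (intros n; apply near_of_holds_at with (psi m x); [apply psi_spec|apply Hq]).
      exists (fun k => W k q), (m, x); split; [intros k; reflexivity|].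
      split; [|split; [exact HnA|exact HA]]; split; cbn [fst snd].
      * unfold W; cbn [Nat.eqb]; unfold base.
        specialize (Hnear 0%nat); change (S (2 * 0)) with 1%nat in Hnear.
        apply hd_filter_seq.
        -- pose proof (near_code _ _ _ _ Hnear); lia.
        -- apply nearb_spec; exact Hnear.
        -- intros m' Hm'; apply Bool.not_true_iff_false; rewrite nearb_spec; intros Hn.
           pose proof (near_unique _ _ _ _ _ _ Hnear Hn) as E; injection E as E; lia.
      * intros n; unfold W; cbn [Nat.eqb]; rewrite Nat.div2_succ_double.
        specialize (Hnear (S n)); set (c := q _) in *.
        enough (E : digit n c = x n) by (rewrite E; reflexivity).
        apply Bool.eq_true_iff_eq; unfold digit; rewrite existsb_exists; split.
        -- intros [m' [_ Hw]]; apply existsb_exists in Hw as [w [Hw%in_words E]].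
           apply Bool.andb_true_iff in E as [E1%nearb_spec E2].
           pose proof (f_equal snd (near_unique _ _ _ _ _ _ Hnear E1)) as E; cbn [snd] in E.
           rewrite <- (nth_prefix x (S n) n false), E, nth_prefix by lia; exact E2.
        -- intros Hx; exists m; split; [pose proof (near_code _ _ _ _ Hnear); apply in_seq; lia|].
           apply existsb_exists; exists (prefix x (S n)); split; [apply in_words, prefix_length|].
           rewrite nth_prefix, Hx by lia; rewrite Bool.andb_true_r; apply nearb_spec.
           unfold near; rewrite (fl_ext m _ x) by (intros; apply nth_prefix; assumption).
           exact Hnear.
Qed.

Theorem theorem9p3 :
  sW_equiv (djump WWKL) (djump PC_C) /\
  sW_equiv (djump PC_C) PC_R /\
  sW_equiv PC_R PC_NC.
Proof.
  pose proof WWKL_le_PC_C as H1; pose proof PC_C_le_PC_NC as H2; pose proof PC_NC_le_WWKL as H3.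
  pose proof PC_NC_le_PC_R as H4; pose proof PC_R_le_PC_NC as H5.
  unfold sW_equiv; repeat split; eauto using @sW_le_trans.
Qed.
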